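(* The category $\mathcal G$ of curved Lie algebras over an algebraically closed field $k$ of characteristic $0$ is a closed model category with the following classes of maps: weak equivalences are the quasi-isomorphisms between uncurved Lie algebras (the weak equivalences of dg Lie algebras) together with all maps between gencurved Lie algebras; fibrations are all surjective maps; cofibrations are all maps which have the left lifting property with respect to acyclic fibrations.
   Context: A curved Lie algebra is a $\mathbb Z$-graded Lie algebra $A$ over $k$ containing a distinguished degree $-2$ element $w_A\in A$ (the curvature), and having a degree $-1$ derivation $d$ (so $d[a,b]=[da,b]+(-1)^{\deg a}[a,db]$) such that $d^2a=[w_A,a]$ for all $a$ and $dw_A=0$. Morphisms respect grading, bracket, $d$ and the curvature. A curved Lie algebra is uncurved if $w_A=0$ (a dg Lie algebra) and gencurved if $w_A\neq0$. An acyclic fibration is a fibration that is also a weak equivalence. A closed model category (CMC) is a category with all small limits and colimits together with classes of weak equivalences, fibrations and cofibrations satisfying Quillen's axioms (two-out-of-three, closure under retracts, lifting, factorization; factorizations not required functorial). *)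

(* Defs.v *)
From HB Require Import structures.
From mathcomp Require Import all_boot all_order all_algebra.
From mathcomp Require Import boolp classical_sets functions.

Set Implicit Arguments.
Unset Strict Implicit.
Unset Printing Implicit Defensive.

Import GRing.Theory.
Local Open Scope classical_set_scope.
Local Open Scope ring_scope.

Record category := Category {
  ob :> Type;
  mor : ob -> ob -> Type;
  cat_id : forall X, mor X X;
  cat_comp : forall X Y Z, mor Y Z -> mor X Y -> mor X Z;
  cat_idl : forall X Y (f : mor X Y), cat_comp (cat_id Y) f = f;
  cat_idr : forall X Y (f : mor X Y), cat_comp f (cat_id X) = f;
  cat_compA : forall X Y Z T (h : mor Z T) (g : mor Y Z) (f : mor X Y),
    cat_comp h (cat_comp g f) = cat_comp (cat_comp h g) f
}.

(* The index categories of small (co)limits. The fields repeat those of       *)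
(* [category] so that the universe of [small_ob] and [small_hom] is           *)
(* independent of that of [ob]: [ob] has to contain the type of all curved    *)
(* Lie algebras, while [small_ob] has to fit below the universe in which the  *)
(* underlying vector spaces of curved Lie algebras live.                      *)
Record small_category := SmallCategory {
  small_ob :> Type;
  small_hom : small_ob -> small_ob -> Type;
  small_id : forall i, small_hom i i;
  small_comp : forall i j l, small_hom j l -> small_hom i j -> small_hom i l;
  small_comp_idl : forall i j (u : small_hom i j),
    small_comp (small_id j) u = u;
  small_comp_idr : forall i j (u : small_hom i j),
    small_comp u (small_id i) = u;
  small_compA : forall i j l m
      (w : small_hom l m) (v : small_hom j l) (u : small_hom i j),
    small_comp w (small_comp v u) = small_comp (small_comp w v) u
}.

Record diagram (J : small_category) (C : category) := Diagram {
  diag_ob :> J -> C;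
  diag_hom : forall i j, small_hom i j -> mor (diag_ob i) (diag_ob j);
  diag_id : forall i, diag_hom (small_id i) = cat_id (diag_ob i);
  diag_comp : forall i j l (v : small_hom j l) (u : small_hom i j),
    diag_hom (small_comp v u) = cat_comp (diag_hom v) (diag_hom u)
}.

Section Limits.
Variables (C : category) (J : small_category) (D : diagram J C).

Definition is_cone (L : C) (p : forall i, mor L (D i)) : Prop :=
  forall i j (u : small_hom i j), cat_comp (diag_hom D u) (p i) = p j.

Definition is_limit (L : C) (p : forall i, mor L (D i)) : Prop :=
  is_cone p /\
  forall (X : C) (q : forall i, mor X (D i)), is_cone q ->
    exists! h : mor X L, forall i, cat_comp (p i) h = q i.

Definition is_cocone (L : C) (p : forall i, mor (D i) L) : Prop :=
  forall i j (u : small_hom i j), cat_comp (p j) (diag_hom D u) = p i.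

Definition is_colimit (L : C) (p : forall i, mor (D i) L) : Prop :=
  is_cocone p /\
  forall (X : C) (q : forall i, mor (D i) X), is_cocone q ->
    exists! h : mor L X, forall i, cat_comp h (p i) = q i.

End Limits.

Definition has_small_limits (C : category) : Prop :=
  forall (J : small_category) (D : diagram J C),
    exists (L : C) (p : forall i, mor L (D i)), is_limit p.

Definition has_small_colimits (C : category) : Prop :=
  forall (J : small_category) (D : diagram J C),
    exists (L : C) (p : forall i, mor (D i) L), is_colimit p.

Definition map_class (C : category) := forall X Y : C, mor X Y -> Prop.

Section ModelCategory.
Variable C : category.
Implicit Types W F K P : map_class C.

Definition map_classI P W : map_class C :=
  fun X Y f => P X Y f /\ W X Y f.

Definition two_out_of_three P : Prop :=
  forall (X Y Z : C) (f : mor X Y) (g : mor Y Z),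
    [/\ P _ _ f -> P _ _ g -> P _ _ (cat_comp g f),
        P _ _ f -> P _ _ (cat_comp g f) -> P _ _ g
      & P _ _ g -> P _ _ (cat_comp g f) -> P _ _ f].

Definition is_retract (A B X Y : C) (f : mor A B) (g : mor X Y) : Prop :=
  exists (i : mor A X) (r : mor X A) (j : mor B Y) (s : mor Y B),
    [/\ cat_comp r i = cat_id A, cat_comp s j = cat_id B,
        cat_comp g i = cat_comp j f & cat_comp f r = cat_comp s g].

Definition retract_closed P : Prop :=
  forall (A B X Y : C) (f : mor A B) (g : mor X Y),
    is_retract f g -> P _ _ g -> P _ _ f.

Definition has_lifting (A B X Y : C) (i : mor A B) (p : mor X Y) : Prop :=
  forall (u : mor A X) (v : mor B Y), cat_comp p u = cat_comp v i ->
    exists h : mor B X, cat_comp h i = u /\ cat_comp p h = v.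

Definition llp P : map_class C :=
  fun A B i => forall (X Y : C) (p : mor X Y), P _ _ p -> has_lifting i p.

Definition factors_as P Q : Prop :=
  forall (X Y : C) (f : mor X Y),
    exists (Z : C) (i : mor X Z) (p : mor Z Y),
      [/\ P _ _ i, Q _ _ p & cat_comp p i = f].

(* [W], [F] and [K] are the weak equivalences, fibrations and cofibrations.   *)
Record closed_model_category W F K : Prop := ClosedModelCategory {
  cmc_limits : has_small_limits C;
  cmc_colimits : has_small_colimits C;
  cmc_two_out_of_three : two_out_of_three W;
  cmc_retract_weq : retract_closed W;
  cmc_retract_fib : retract_closed F;
  cmc_retract_cof : retract_closed K;
  cmc_lift_cof_acyclic_fib :
    forall (A B X Y : C) (i : mor A B) (p : mor X Y),
      K _ _ i -> map_classI F W p -> has_lifting i p;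
  cmc_lift_acyclic_cof_fib :
    forall (A B X Y : C) (i : mor A B) (p : mor X Y),
      map_classI K W i -> F _ _ p -> has_lifting i p;
  cmc_factor_cof_acyclic_fib : factors_as K (map_classI F W);
  cmc_factor_acyclic_cof_fib : factors_as (map_classI K W) F
}.

End ModelCategory.

(* Operations on graded objects take a proof of the degree equation, as in    *)
(* [br : i + j = n -> A i -> A j -> A n], so that no casts along equalities   *)
(* of degrees occur in the axioms. As [int] has unique identity proofs, this  *)
(* is the same data as [A i -> A j -> A (i + j)].                             *)
Record gradedLie (k : fieldType) := GradedLie {
  gr :> int -> lmodType k;
  br : forall i j n : int, i + j = n -> gr i -> gr j -> gr n;
  br_linearl : forall (i j n : int) (e : i + j = n) (b : gr j),
    linear (fun a => br e a b);
  br_linearr : forall (i j n : int) (e : i + j = n) (a : gr i),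
    linear (br e a);
  br_antisym : forall (i j n : int) (e : i + j = n) (e' : j + i = n)
      (a : gr i) (b : gr j),
    br e a b = - ((-1) ^ (i * j) *: br e' b a);
  br_jacobi : forall (i j l ij jl il n : int)
      (eij : i + j = ij) (ejl : j + l = jl) (eil : i + l = il)
      (e1 : i + jl = n) (e2 : ij + l = n) (e3 : j + il = n)
      (a : gr i) (b : gr j) (c : gr l),
    br e1 a (br ejl b c) =
      br e2 (br eij a b) c + (-1) ^ (i * j) *: br e3 b (br eil a c)
}.

Record curvedLie (k : fieldType) := CurvedLie {
  lie :> gradedLie k;
  ldiff : forall i j : int, i - 1 = j -> {linear lie i -> lie j};
  curv : lie (- 2%:Z);
  ldiff_br : forall (i j n i' j' n' : int)
      (e : i + j = n) (ei : i - 1 = i') (ej : j - 1 = j') (en : n - 1 = n')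
      (e1 : i' + j = n') (e2 : i + j' = n') (a : lie i) (b : lie j),
    ldiff en (br e a b) =
      br e1 (ldiff ei a) b + (-1) ^ i *: br e2 a (ldiff ej b);
  ldiff_ldiff : forall (i j n : int) (e : i - 1 = j) (e' : j - 1 = n)
      (ew : - 2%:Z + i = n) (a : lie i),
    ldiff e' (ldiff e a) = br ew curv a;
  ldiff_curv : forall (n : int) (e : - 2%:Z - 1 = n), ldiff e curv = 0
}.

Record curvedLie_hom (k : fieldType) (A B : curvedLie k) := CurvedLieHom {
  hom_fun :> forall i : int, {linear A i -> B i};
  hom_br : forall (i j n : int) (e : i + j = n) (a : A i) (b : A j),
    hom_fun n (br e a b) = br e (hom_fun i a) (hom_fun j b);
  hom_ldiff : forall (i j : int) (e : i - 1 = j) (a : A i),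
    hom_fun j (ldiff A e a) = ldiff B e (hom_fun i a);
  hom_curv : hom_fun (- 2%:Z) (curv A) = curv B
}.

Section CurvedLieCategory.
Variable k : fieldType.
Implicit Types A B D E : curvedLie k.

Lemma linear_funext (U V : lmodType k) (f g : {linear U -> V}) :
  f =1 g -> f = g.
Proof.
move=> /funext; case: f g => [f cf] [g cg] /= fg; subst g.
congr GRing.Linear.Pack; case: cf cg => [[a] [b]] [[a'] [b']].
by rewrite (Prop_irrelevance a a') (Prop_irrelevance b b').
Qed.

Lemma curvedLie_hom_ext A B (f g : curvedLie_hom A B) :
  (forall i, f i =1 g i) -> f = g.
Proof.
move=> fg; have {fg} : hom_fun f = hom_fun g.
  by apply: functional_extensionality_dep => i; apply: linear_funext.
case: f g => [f f1 f2 f3] [g g1 g2 g3] /= fg; subst g.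
by congr CurvedLieHom; apply: Prop_irrelevance.
Qed.

Definition curvedLie_id A : curvedLie_hom A A.
Proof. by exists (fun i => idfun). Defined.

Definition curvedLie_comp A B D
    (g : curvedLie_hom B D) (f : curvedLie_hom A B) : curvedLie_hom A D.
Proof.
exists (fun i => g i \o f i) => [i j n e a b|i j e a|] /=.
- by rewrite !hom_br.
- by rewrite !hom_ldiff.
- by rewrite !hom_curv.
Defined.

Lemma curvedLie_comp_idl A B (f : curvedLie_hom A B) :
  curvedLie_comp (curvedLie_id B) f = f.
Proof. exact: curvedLie_hom_ext. Qed.

Lemma curvedLie_comp_idr A B (f : curvedLie_hom A B) :
  curvedLie_comp f (curvedLie_id A) = f.
Proof. exact: curvedLie_hom_ext. Qed.

Lemma curvedLie_compA A B D E (h : curvedLie_hom D E)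
    (g : curvedLie_hom B D) (f : curvedLie_hom A B) :
  curvedLie_comp h (curvedLie_comp g f) = curvedLie_comp (curvedLie_comp h g) f.
Proof. exact: curvedLie_hom_ext. Qed.

Definition curvedLie_category : category :=
  Category curvedLie_comp_idl curvedLie_comp_idr curvedLie_compA.

Definition uncurved A : Prop := curv A = 0.
Definition gencurved A : Prop := curv A <> 0.

Definition cycles A (n : int) : set (A n) :=
  [set z | ldiff A (erefl (n - 1)) z = 0].
Arguments cycles : clear implicits.

Definition boundaries A (n : int) : set (A n) :=
  range (ldiff A (addrK 1 n)).
Arguments boundaries : clear implicits.

Definition homology_class A (n : int) (z : A n) : set (A n) :=
  [set z + b | b in boundaries A n].

(* The quotient of cycles by boundaries, as its set of cosets. It is only     *)
(* meaningful when [A] is uncurved, so that the differential squares to zero. *)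
Definition homology A (n : int) : set (set (A n)) :=
  [set homology_class z | z in cycles A n].
Arguments homology : clear implicits.

(* The induced map in homology: [f] applied to a coset spans a unique coset,  *)
(* see [homology_map_class].                                                  *)
Definition homology_map A B (f : curvedLie_hom A B) (n : int)
    (c : set (A n)) : set (B n) :=
  [set f n x + b | x in c & b in boundaries B n].

Lemma homology_map_class A B (f : curvedLie_hom A B) (n : int) (z : A n) :
  homology_map f (homology_class z) = homology_class (f n z).
Proof.
apply/seteqP; split => y.
  move=> [x [_ [a _ <-] <-]] [_ [b _ <-] <-].
  exists (ldiff B (addrK 1 n) (f (n + 1) a + b)).
    by exists (f (n + 1) a + b).
  by rewrite !linearD hom_ldiff addrA.
move=> [b Bb <-]; exists z; last by exists b.
by exists 0; [exists 0; rewrite ?linear0|rewrite addr0].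
Qed.

Definition quasi_isomorphism A B (f : curvedLie_hom A B) : Prop :=
  forall n : int,
    set_bij (homology A n) (homology B n) (homology_map f (n := n)).

Definition weak_equivalence : map_class curvedLie_category :=
  fun A B f =>
    [/\ uncurved A, uncurved B & quasi_isomorphism f] \/
    (gencurved A /\ gencurved B).

Definition fibration : map_class curvedLie_category :=
  fun A B f => forall (n : int) (y : B n), exists x : A n, f n x = y.

Definition acyclic_fibration : map_class curvedLie_category :=
  map_classI fibration weak_equivalence.

Definition cofibration : map_class curvedLie_category :=
  llp acyclic_fibration.

End CurvedLieCategory.

Arguments cycles {k} A n _.
Arguments boundaries {k} A n _.
Arguments homology {k} A n _.

(* Main.v *)
Require Import Defs.
From HB Require Import structures.
From mathcomp Require Import all_boot all_order all_algebra.
From mathcomp Require Import boolp classical_sets functions.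

Set Implicit Arguments.
Unset Strict Implicit.
Unset Printing Implicit Defensive.

Import GRing.Theory.
Local Open Scope ring_scope.

(** Limits of curved Lie algebras are computed on underlying graded spaces, and
    colimits are quotients of algebras of formal terms. Two out of three and
    closure under retracts reduce to diagram chases in homology: a morphism out
    of an uncurved algebra has an uncurved target, so in each of these axioms
    the algebras involved are all uncurved or all gencurved. The content is in
    the two factorizations.

    Both come from one construction. Given [f : X -> Y], a filler algebra is a
    curved Lie algebra [M] with maps [X -> M -> Y] factoring [f] and an
    operation that assigns to [c] in [M] and [y] in [Y], one degree higher, an
    element [fill c y] of [M] over [y]. Under a flag [s] one also asks that [M]
    be uncurved and that [fill c y] have differential [c] whenever [c] is a
    cycle whose image is the differential of [y]. Such structures are algebras
    for an essentially algebraic theory, so there is an initial one, [Z]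
    ([initial_filler_algebra]). It plays the role of the transfinite cell
    attachment of the small object argument.

    The operation makes [Z -> Y] surjective, and, under [s], it makes it a
    surjective quasi-isomorphism. Conversely, [X -> Z] lifts against every
    surjection [q : E -> B] for which the same filling problems can be solved:
    given a square, the pullback of [q] along [Z -> B] is again a filler algebra
    by choosing solutions, so initiality provides a section of its projection to
    [Z], and the second projection of this section is the lift
    ([initial_filler_lift]).

    With [s := uncurved Y] this is the factorization into a cofibration and an
    acyclic fibration. It treats uniformly the case where [Y] is gencurved, in
    which [Z] freely adds generators without relations, and the case where [X]
    is gencurved and [Y] is not, in which [Z] starts with killing the curvature
    of [X]. With [s := False], the map [X -> Z] lifts against all surjections,
    and it remains to see that it is a weak equivalence
    ([base_quasi_isomorphism]). If [X] is gencurved then so is [Z], as [X] is a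
    retract of [Z]. If [X] is uncurved, [Z] is [X] with generators [v] and [dv]
    adjoined freely. The derivation [D] that vanishes on [X] and fixes every [v]
    counts generators and equals [dh + hd] for a derivation [h] of degree one,
    so it vanishes in homology; on the part of weight [m > 0] it is
    multiplication by [m], which is invertible in characteristic zero. Hence
    only the part of weight zero, the image of [X], contributes to homology.

    Acyclic cofibrations lift against fibrations because each of them is a
    retract of the inclusion [X -> Z] of the second factorization. *)

(** * Curved Lie algebras from separated operations *)

Definition linear_of (k : fieldType) (U V : lmodType k) (f : U -> V)
    (lf : linear f) : {linear U -> V} :=
  HB.pack f (GRing.isLinear.Build _ _ _ _ f lf).

Record rawLie (k : fieldType) := RawLie {
  raw_car :> int -> Type;
  raw_zero : forall n, raw_car n;
  raw_add : forall n, raw_car n -> raw_car n -> raw_car n;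
  raw_scale : forall n, k -> raw_car n -> raw_car n;
  raw_br : forall i j n : int, i + j = n ->
    raw_car i -> raw_car j -> raw_car n;
  raw_diff : forall i j : int, i - 1 = j -> raw_car i -> raw_car j;
  raw_curv : raw_car (- 2%:Z)
}.

Record rawHom (k : fieldType) (R : rawLie k) (A : curvedLie k) := RawHom {
  raw_fun :> forall n, R n -> A n;
  raw_fun0 : forall n, raw_fun (raw_zero R n) = 0;
  raw_funD : forall n (a b : R n),
    raw_fun (raw_add a b) = raw_fun a + raw_fun b;
  raw_funZ : forall n c (a : R n), raw_fun (raw_scale c a) = c *: raw_fun a;
  raw_fun_br : forall (i j n : int) (e : i + j = n) (a : R i) (b : R j),
    raw_fun (raw_br e a b) = br e (raw_fun a) (raw_fun b);
  raw_fun_diff : forall (i j : int) (e : i - 1 = j) (a : R i),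
    raw_fun (raw_diff e a) = ldiff A e (raw_fun a);
  raw_fun_curv : raw_fun (raw_curv R) = curv A
}.

(** All axioms of curved Lie algebras are equations between composites of the
    operations. If maps into curved Lie algebras that preserve the operations
    separate points, the axioms can be checked after applying such maps, hence
    hold. Subalgebras of products and quotients of term algebras are both of
    this kind. *)
Definition separated (k : fieldType) (R : rawLie k) : Prop :=
  forall n (a b : R n),
    (forall (A : curvedLie k) (h : rawHom R A), h n a = h n b) -> a = b.

Section LieOfRaw.
Variables (k : fieldType) (R : rawLie k) (sepR : separated R).

(** An alias of the carrier, to attach the module structure to. *)
Definition raw_mod (n : int) : Type := R n.

Section Module.
Variable n : int.
Let M := raw_mod n.

HB.instance Definition _ := gen_eqMixin M.
HB.instance Definition _ := gen_choiceMixin M.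

Let opp (a : M) : M := raw_scale (-1) a.
Let add (a b : M) : M := raw_add a b.
Let scale c (a : M) : M := raw_scale c a.

Ltac sep := apply: sepR => A h;
  rewrite /add /opp /scale /= ?(raw_funD, raw_funZ, raw_fun0).

Let addA : associative add.
Proof. by move=> a b c; sep; rewrite addrA. Qed.
Let addC : commutative add.
Proof. by move=> a b; sep; rewrite addrC. Qed.
Let add0 : left_id (raw_zero R n : M) add.
Proof. by move=> a; sep; rewrite add0r. Qed.
Let addN : left_inverse (raw_zero R n : M) opp add.
Proof. by move=> a; sep; rewrite scaleN1r addNr. Qed.

HB.instance Definition _ := GRing.isZmodule.Build M addA addC add0 addN.

Let scaleA : forall a b v, scale a (scale b v) = scale (a * b) v.
Proof. by move=> a b v; sep; rewrite scalerA. Qed.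
Let scale1 : left_id 1 scale.
Proof. by move=> v; sep; rewrite scale1r. Qed.
Let scaleDr : right_distributive scale +%R.
Proof. by move=> a u v; sep; rewrite scalerDr. Qed.
Let scaleDl : forall v, {morph scale^~ v: a b / a + b}.
Proof. by move=> v a b; sep; rewrite scalerDl. Qed.

HB.instance Definition _ :=
  GRing.Zmodule_isLmodule.Build k M scaleA scale1 scaleDr scaleDl.

End Module.

Definition raw_lmod (n : int) : lmodType k := raw_mod n.

Lemma raw_modD n (a b : raw_lmod n) : a + b = raw_add a b :> R n.
Proof. by []. Qed.
Lemma raw_modZ n c (a : raw_lmod n) : c *: a = raw_scale c a :> R n.
Proof. by []. Qed.
Lemma raw_modN n (a : raw_lmod n) : - a = raw_scale (-1) a :> R n.
Proof. by []. Qed.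
Lemma raw_mod0 n : (0 : raw_lmod n) = raw_zero R n :> R n.
Proof. by []. Qed.

Let rawE := (raw_modD, raw_modZ, raw_modN, raw_mod0, raw_funD, raw_funZ,
  raw_fun0, raw_fun_br, raw_fun_diff, raw_fun_curv).

Let br_linl (i j n : int) (e : i + j = n) (b : raw_lmod j) :
  linear (fun a : raw_lmod i => raw_br e a b : raw_lmod n).
Proof.
move=> c u v; apply: sepR => A h.
by rewrite !rawE (br_linearl e (h j b)).
Qed.

Let br_linr (i j n : int) (e : i + j = n) (a : raw_lmod i) :
  linear (raw_br e a : raw_lmod j -> raw_lmod n).
Proof. by move=> c u v; apply: sepR => A h; rewrite !rawE br_linearr. Qed.

Let br_anti (i j n : int) (e : i + j = n) (e' : j + i = n)
    (a : raw_lmod i) (b : raw_lmod j) :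
  raw_br e a b = - ((-1) ^ (i * j) *: (raw_br e' b a : raw_lmod n)).
Proof.
apply: sepR => A h.
by rewrite !rawE (br_antisym e e') scaleN1r.
Qed.

Let br_jac (i j l ij jl il n : int)
    (eij : i + j = ij) (ejl : j + l = jl) (eil : i + l = il)
    (e1 : i + jl = n) (e2 : ij + l = n) (e3 : j + il = n)
    (a : raw_lmod i) (b : raw_lmod j) (c : raw_lmod l) :
  raw_br e1 a (raw_br ejl b c) = (raw_br e2 (raw_br eij a b) c : raw_lmod n)
    + (-1) ^ (i * j) *: (raw_br e3 b (raw_br eil a c) : raw_lmod n).
Proof.
apply: sepR => A h.
by rewrite !rawE (br_jacobi eij ejl eil e1 e2 e3).
Qed.

Definition lie_of_raw_graded : gradedLie k :=
  @GradedLie k raw_lmod (@raw_br k R) br_linl br_linr br_anti br_jac.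

Let diff_linear i j (e : i - 1 = j) :
  linear (@raw_diff k R i j e : raw_lmod i -> raw_lmod j).
Proof. by move=> c u v; apply: sepR => A h; rewrite !rawE linearP. Qed.

Definition lie_of_raw_diff i j (e : i - 1 = j) :
    {linear raw_lmod i -> raw_lmod j} :=
  linear_of (diff_linear e).

Definition lie_of_raw : curvedLie k.
Proof.
exists lie_of_raw_graded lie_of_raw_diff (raw_curv R).
- move=> i j n i' j' n' e ei ej en e1 e2 a b; apply: sepR => A h.
  by rewrite /= !rawE (ldiff_br e ei ej en e1 e2).
- move=> i j n e e' ew a; apply: sepR => A h.
  by rewrite /= !rawE (ldiff_ldiff e e' ew).
- move=> n e; apply: sepR => A h.
  by rewrite /= !rawE ldiff_curv.
Defined.

Section HomOfRaw.
Variables (A : curvedLie k) (h : rawHom R A).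

Let h_linear n : linear (h n : raw_lmod n -> A n).
Proof. by move=> c u v; rewrite !rawE. Qed.

Definition hom_of_raw : curvedLie_hom lie_of_raw A.
Proof.
exists (fun n => linear_of (@h_linear n)).
- by move=> *; rewrite /= !rawE.
- by move=> *; rewrite /= !rawE.
- by rewrite /= !rawE.
Defined.

End HomOfRaw.

End LieOfRaw.

(** A function into [P] is a morphism as soon as it becomes one after
    composition with enough morphisms out of [P] to separate points. *)
Lemma hom_of_joint (k : fieldType) (X P : curvedLie k)
    (F : forall n, X n -> P n) :
  (forall n (a b : P n),
    (forall (A : curvedLie k) (h : curvedLie_hom P A) (f : curvedLie_hom X A),
      (forall m x, h m (F m x) = f m x) -> h n a = h n b) -> a = b) ->
  exists g : curvedLie_hom X P, forall n x, g n x = F n x.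
Proof.
move=> sep.
have F_lin n : linear (F n).
  by move=> c u v; apply: sep => A h f hF; rewrite !linearP !hF linearP.
unshelve eexists (@CurvedLieHom k X P (fun n => linear_of (F_lin n)) _ _ _).
- move=> i j n e a b; apply: sep => A h f hF.
  by rewrite /= hom_br !hF hom_br.
- move=> i j e a; apply: sep => A h f hF.
  by rewrite /= hom_ldiff !hF hom_ldiff.
- by apply: sep => A h f hF; rewrite /= hF !hom_curv.
- by [].
Qed.

(** * Subalgebras of products, and limits *)

Record subproduct_closed (k : fieldType) (J : Type) (A : J -> curvedLie k)
    (S : forall n, (forall j, A j n) -> Prop) : Prop := SubproductClosed {
  sub_zero : forall n, S n (fun j => 0);
  sub_add : forall n a b, S n a -> S n b -> S n (fun j => a j + b j);
  sub_scale : forall n c a, S n a -> S n (fun j => c *: a j);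
  sub_br : forall (i j n : int) (e : i + j = n) a b,
    S i a -> S j b -> S n (fun l => br e (a l) (b l));
  sub_diff : forall (i j : int) (e : i - 1 = j) a,
    S i a -> S j (fun l => ldiff (A l) e (a l));
  sub_curv : S (- 2%:Z) (fun j => curv (A j))
}.

Section Subproduct.
Variables (k : fieldType) (J : Type) (A : J -> curvedLie k).
Variable S : forall n, (forall j, A j n) -> Prop.
Hypothesis clS : subproduct_closed S.

Let car n := {a : forall j, A j n | S a}.

Let car_eq n (a b : car n) : (forall j, sval a j = sval b j) -> a = b.
Proof.
case: a b => [a Sa] [b Sb] /= ab; apply: eq_exist.
exact: functional_extensionality_dep.
Qed.

Definition subproduct_raw : rawLie k := @RawLie k car
  (fun n => exist (@S n) _ (sub_zero clS n))
  (fun n (a b : car n) => exist (@S n) _ (sub_add clS (svalP a) (svalP b)))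
  (fun n c (a : car n) => exist (@S n) _ (sub_scale clS c (svalP a)))
  (fun i j n e (a : car i) (b : car j) =>
    exist (@S n) _ (sub_br clS e (svalP a) (svalP b)))
  (fun i j e (a : car i) => exist (@S j) _ (sub_diff clS e (svalP a)))
  (exist (@S _) _ (sub_curv clS)).

Definition subproduct_proj (j : J) : rawHom subproduct_raw (A j).
Proof. by exists (fun n (a : car n) => sval a j). Defined.

Lemma subproduct_separated : separated subproduct_raw.
Proof.
by move=> n a b ab; apply: car_eq => j; apply: (ab _ (subproduct_proj j)).
Qed.

Lemma subproduct_exists :
  exists (P : curvedLie k) (p : forall j, curvedLie_hom P (A j)),
    [/\ forall n (a b : P n), (forall j, p j n a = p j n b) -> a = b,
        forall n (a : P n), S (fun j => p j n a)
      & forall n (a : forall j, A j n), S a ->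
          exists b : P n, forall j, p j n b = a j].
Proof.
exists (lie_of_raw subproduct_separated).
exists (fun j => hom_of_raw subproduct_separated (subproduct_proj j)).
split=> [n a b ab|n a|n a Sa].
- by apply: car_eq.
- exact: (svalP a).
- by exists (exist (@S n) a Sa).
Qed.

End Subproduct.

Lemma subproduct_lift (k : fieldType) (J : Type) (A : J -> curvedLie k)
    (P X : curvedLie k) (p : forall j, curvedLie_hom P (A j))
    (f : forall j, curvedLie_hom X (A j)) :
  (forall n (a b : P n), (forall j, p j n a = p j n b) -> a = b) ->
  (forall n (x : X n), exists b : P n, forall j, p j n b = f j n x) ->
  exists h : curvedLie_hom X P, forall j n x, p j n (h n x) = f j n x.
Proof.
move=> p_inj ex_lift.
pose F n x := sval (cid (ex_lift n x)).
have pF j n x : p j n (F n x) = f j n x by rewrite /F; case: cid.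
have [n a b ab|h hF] := @hom_of_joint k X P F.
  by apply: p_inj => j; apply: ab (p j) (f j) (pF j).
by exists h => j n x; rewrite hF pF.
Qed.

Lemma hom_compE (k : fieldType) (X Y Z : curvedLie_category k)
    (g : mor Y Z) (f : mor X Y) n x :
  (cat_comp g f : curvedLie_hom X Z) n x = g n (f n x).
Proof. by []. Qed.

Lemma curvedLie_has_small_limits (k : fieldType) :
  has_small_limits (curvedLie_category k).
Proof.
move=> J D.
pose A j : curvedLie k := D j.
pose S n (a : forall j, A j n) :=
  forall i j (u : small_hom i j), (diag_hom D u) n (a i) = a j.
have clS : @subproduct_closed k J A S.
  split.
  - by move=> n i j u; rewrite linear0.
  - by move=> n a b Sa Sb i j u; rewrite linearD Sa Sb.
  - by move=> n c a Sa i j u; rewrite linearZ /= Sa.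
  - by move=> i j n e a b Sa Sb i' j' u; rewrite hom_br Sa Sb.
  - by move=> i j e a Sa i' j' u; rewrite hom_ldiff Sa.
  - by move=> i j u; rewrite hom_curv.
have [P [p [p_inj pS p_surj]]] := subproduct_exists clS.
exists P, p; split.
  by move=> i j u; apply: curvedLie_hom_ext => n x; apply: pS.
move=> X q q_cone.
have [n x|h hp] := subproduct_lift p_inj (f := q) (X := X).
  apply: p_surj => i j u.
  exact: (congr1 (fun g : curvedLie_hom X (D j) => g n x) (q_cone i j u)).
exists h; split.
  by move=> j; apply: curvedLie_hom_ext => n x; apply: hp.
move=> h' hp'; apply: curvedLie_hom_ext => n x; apply: p_inj => j.
by rewrite hp -(hp' j).
Qed.

(** * Models presented by generators and operations *)

Lemma cid_ext (T : Type) (P Q : T -> Prop)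
    (eP : exists x, P x) (eQ : exists x, Q x) :
  P = Q -> sval (cid eP) = sval (cid eQ).
Proof. by move=> PQ; subst Q; rewrite (Prop_irrelevance eP eQ). Qed.

Section TermModel.
Variables (k : fieldType) (G : int -> Type) (O : int -> int -> Type).

(** Besides the generators, a model carries arbitrary unary operations. They are
    total functions that satisfy no law and need not be linear, so that
    conditional laws can later be imposed on them. *)
Record model := Model {
  model_lie :> curvedLie k;
  model_gen : forall n, G n -> model_lie n;
  model_op : forall n m, O n m -> model_lie n -> model_lie m
}.

Record model_hom (M N : model) := ModelHom {
  model_fun :> curvedLie_hom M N;
  model_fun_gen : forall n (x : G n),
    model_fun n (model_gen M x) = model_gen N x;
  model_fun_op : forall n m (o : O n m) (a : M n),
    model_fun m (model_op o a) = model_op o (model_fun n a)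
}.

Record submodel (M : model) (P : forall n, M n -> Prop) : Prop := Submodel {
  submodel_zero : forall n, P n 0;
  submodel_add : forall n a b, P n a -> P n b -> P n (a + b);
  submodel_scale : forall n c a, P n a -> P n (c *: a);
  submodel_br : forall (i j n : int) (e : i + j = n) a b,
    P i a -> P j b -> P n (br e a b);
  submodel_diff : forall (i j : int) (e : i - 1 = j) a,
    P i a -> P j (ldiff M e a);
  submodel_curv : P (- 2%:Z) (curv M);
  submodel_gen : forall n (x : G n), P n (model_gen M x);
  submodel_op : forall n m (o : O n m) a, P n a -> P m (model_op o a)
}.

Definition generated (M : model) : Prop :=
  forall P : (forall n, M n -> Prop), submodel P -> forall n a, P n a.

Lemma generated_hom_eq (M N : model) (f g : model_hom M N) :
  generated M -> forall n a, f n a = g n a.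
Proof.
move=> genM; apply: genM; split.
- by move=> n; rewrite !linear0.
- by move=> n a b fa fb; rewrite !linearD fa fb.
- by move=> n c a fa; rewrite !linearZ /= fa.
- by move=> i j n e a b fa fb; rewrite !hom_br fa fb.
- by move=> i j e a fa; rewrite !hom_ldiff fa.
- by rewrite !hom_curv.
- by move=> n x; rewrite !model_fun_gen.
- by move=> n m o a fa; rewrite !model_fun_op fa.
Qed.

Lemma generated_endo (M : model) (f : model_hom M M) :
  generated M -> forall n a, f n a = a.
Proof.
have gen_id n (x : G n) :
  curvedLie_id M n (model_gen M x) = model_gen M x by [].
have op_id n m (o : O n m) (a : M n) :
  curvedLie_id M m (model_op o a) = model_op o (curvedLie_id M n a) by [].
exact: (generated_hom_eq f (ModelHom gen_id op_id)).
Qed.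

Inductive term : int -> Type :=
| TGen n of G n : term n
| TOp n m of O n m & term n : term m
| TZero n : term n
| TAdd n of term n & term n : term n
| TScale n of k & term n : term n
| TBr i j n of i + j = n & term i & term j : term n
| TDiff i j of i - 1 = j & term i : term j
| TCurv : term (- 2%:Z).

Fixpoint term_val (M : model) n (t : term n) : M n :=
  match t with
  | TGen n x => model_gen M x
  | TOp n m o t => model_op o (term_val M t)
  | TZero n => 0
  | TAdd n s t => term_val M s + term_val M t
  | TScale n c t => c *: term_val M t
  | TBr i j n e s t => br e (term_val M s) (term_val M t)
  | TDiff i j e t => ldiff M e (term_val M t)
  | TCurv => curv M
  end.

(** The model of terms that is freest among those separated by [Phi]: two terms
    are identified when every model in [Phi] gives them the same value. Each
    element of the class maps to [Phi]-models compatibly, so this model is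
    initial among the members of [Phi] once it is known to belong to [Phi]. *)
Variable Phi : model -> Prop.

Definition term_eq n (s t : term n) : Prop :=
  forall M, Phi M -> term_val M s = term_val M t.

(** The class of a term depends only on the set of equivalent terms, so choosing
    an element of that set gives canonical representatives; the quotient is
    then the type of terms that are their own representative. *)
Definition term_rep n (t : term n) : term n :=
  sval (cid (ex_intro (term_eq t) t (fun M _ => erefl (term_val M t)))).

Lemma term_val_rep n (t : term n) (M : model) :
  Phi M -> term_val M (term_rep t) = term_val M t.
Proof. by rewrite /term_rep; case: cid => s /= ts /ts. Qed.

Lemma term_rep_eq n (s t : term n) : term_eq s t -> term_rep s = term_rep t.
Proof.
move=> st; apply: cid_ext.
apply: functional_extensionality_dep => u; apply/propext.
by split=> su M PM; [rewrite -(st M PM)|rewrite (st M PM)]; apply: su.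
Qed.

Let car n := {t : term n | term_rep t = t}.

Definition term_class n (t : term n) : car n :=
  exist _ (term_rep t) (term_rep_eq (fun M => @term_val_rep n t M)).

Definition term_raw : rawLie k := @RawLie k car
  (fun n => term_class (TZero n))
  (fun n (a b : car n) => term_class (TAdd (sval a) (sval b)))
  (fun n c (a : car n) => term_class (TScale c (sval a)))
  (fun i j n e (a : car i) (b : car j) => term_class (TBr e (sval a) (sval b)))
  (fun i j e (a : car i) => term_class (TDiff e (sval a)))
  (term_class TCurv).

Definition term_eval (M : model) (PM : Phi M) : rawHom term_raw M.
Proof.
by exists (fun n (a : car n) => term_val M (sval a)) => *; apply: term_val_rep.
Defined.

Lemma term_class_eq n (a b : car n) :
  (forall M, Phi M -> term_val M (sval a) = term_val M (sval b)) -> a = b.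
Proof.
case: a b => [s rs] [t rt] /= st; apply: eq_exist.
by rewrite -rs -rt; apply: term_rep_eq.
Qed.

Lemma term_classK n (a : car n) : term_class (sval a) = a.
Proof. by apply: term_class_eq => M PM; apply: term_val_rep. Qed.

Lemma term_raw_separated : separated term_raw.
Proof.
by move=> n a b ab; apply: term_class_eq => M PM; apply: (ab M (term_eval PM)).
Qed.

Definition term_model : model :=
  @Model (lie_of_raw term_raw_separated) (fun n x => term_class (TGen x))
    (fun n m o (a : car n) => term_class (TOp o (sval a))).

Definition term_model_hom (M : model) (PM : Phi M) : model_hom term_model M.
Proof.
exists (hom_of_raw term_raw_separated (term_eval PM)) => *.
  exact: term_val_rep.
exact: term_val_rep.
Defined.

Lemma term_model_generated : generated term_model.
Proof.
move=> P clP n a; rewrite -(term_classK a).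
elim: (sval a) => {n a} [n x|n m o t Pt|n|n s Ps t Pt|n c t Pt
  |i j n e s Ps t Pt|i j e t Pt|].
- exact: (submodel_gen clP).
- rewrite (_ : term_class _ = model_op o (term_class t : term_model n)).
    exact: submodel_op.
  by apply: term_class_eq => M PM; rewrite !term_val_rep //= term_val_rep.
- exact: (submodel_zero clP).
- rewrite (_ : term_class _ =
    (term_class s : term_model n) + (term_class t : term_model n)).
    exact: submodel_add.
  by apply: term_class_eq => M PM; rewrite !term_val_rep //= !term_val_rep.
- rewrite (_ : term_class _ = c *: (term_class t : term_model n)).
    exact: submodel_scale.
  by apply: term_class_eq => M PM; rewrite !term_val_rep //= !term_val_rep.
- rewrite (_ : term_class _ =
    br e (term_class s : term_model i) (term_class t : term_model j)).
    exact: submodel_br.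
  by apply: term_class_eq => M PM; rewrite !term_val_rep //= !term_val_rep.
- rewrite (_ : term_class _ = ldiff term_model e (term_class t : term_model i)).
    exact: submodel_diff.
  by apply: term_class_eq => M PM; rewrite !term_val_rep //= !term_val_rep.
- exact: (submodel_curv clP).
Qed.

(** This is how membership of [term_model] in [Phi] is proved in each use:
    an equation holds as soon as it holds in all members of [Phi]. *)
Lemma term_model_separated n (a b : term_model n) :
  (forall M (h : model_hom term_model M), Phi M -> h n a = h n b) -> a = b.
Proof.
move=> ab; apply: term_class_eq => M PM.
exact: (ab M (term_model_hom PM) PM).
Qed.

End TermModel.

(** * Colimits *)

(** A cocone under [D] is a model whose generators are the elements of all the
    [D j], subject to the condition that the generators from each [D j] form a
    morphism, compatibly with the arrows of the diagram. *)
Lemma curvedLie_has_small_colimits (k : fieldType) :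
  has_small_colimits (curvedLie_category k).
Proof.
move=> J D.
pose G n := {j : J & (D j : curvedLie k) n}.
pose O (_ _ : int) := void.
pose cocone (M : model k G O) (q : forall j, curvedLie_hom (D j) M) :=
  @is_cocone _ _ D (M : curvedLie k) q /\
  forall j n (a : (D j : curvedLie k) n), model_gen M (existT _ j a) = q j n a.
pose Phi M := exists q, @cocone M q.
pose L := term_model Phi.
have [q [q_cocone qE]] : Phi L.
  have ex_q j : exists q : curvedLie_hom (D j) L,
      forall n a, q n a = model_gen L (existT _ j a).
    apply: (hom_of_joint (F := fun n a => model_gen L (existT _ j a))).
    move=> n a b ab; apply: term_model_separated => M h [q [_ qE]].
    by apply: (ab M h (q j)) => m x; rewrite model_fun_gen qE.
  pose q j := sval (cid (ex_q j)).
  have qE j : forall n a, q j n a = model_gen L (existT _ j a).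
    exact: svalP (cid (ex_q j)).
  exists q; split; last by move=> j n a; rewrite qE.
  move=> i j u; apply: curvedLie_hom_ext => n a.
  apply: term_model_separated => M h [r [r_cocone rE]].
  rewrite hom_compE !qE !model_fun_gen !rE.
  exact: (congr1 (fun g : curvedLie_hom (D i) M => g n a) (r_cocone i j u)).
exists (L : curvedLie k), q; split=> // X r r_cocone.
pose X' : model k G O :=
  @Model k G O X (fun n x => r (projT1 x) n (projT2 x)) (fun n m o a => 0).
have PX' : Phi X' by exists r.
pose h0 := term_model_hom PX'.
exists (h0 : curvedLie_hom L X); split.
  move=> j; apply: curvedLie_hom_ext => n a.
  by rewrite hom_compE -qE (model_fun_gen h0).
move=> h hq; apply: curvedLie_hom_ext => n a.
have h_gen m (x : G m) : h m (model_gen L x) = model_gen X' x.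
  by case: x => j x; rewrite /= -(hq j) hom_compE -qE.
have h_op m m' (o : O m m') b : h m' (@model_op k G O L m m' o b) = 0.
  by case: o.
pose h' := @ModelHom k G O L X' h h_gen h_op.
exact: (generated_hom_eq h0 h' (@term_model_generated _ _ _ _)).
Qed.

(** * Filler algebras *)

Section FillerAlgebra.
Variables (k : fieldType) (X Y : curvedLie k) (f : curvedLie_hom X Y).
Variable s : Prop.

Definition fill_gens (n : int) : Type := X n.

(** One operation for each element of [Y]; the degree equation is part of its
    name, so that no transport along degrees is needed. *)
Definition fill_op (n m : int) : Type := ((m - 1 = n) * Y m)%type.

Definition fill_model := model k fill_gens fill_op.

Definition fill (M : fill_model) n m (e : m - 1 = n) (c : M n) (y : Y m) :
  M m := @model_op _ _ _ M n m (e, y) c.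

Record filler_algebra (M : fill_model) (i : curvedLie_hom X M)
    (p : curvedLie_hom M Y) : Prop := FillerAlgebra {
  fill_gen : forall n x, model_gen M x = i n x;
  fill_over : forall n x, p n (i n x) = f n x;
  fill_fill : forall n m (e : m - 1 = n) (c : M n) (y : Y m),
    p m (fill e c y) = y;
  fill_curv : s -> curv M = 0;
  fill_diff : s -> forall n m (e : m - 1 = n) (c : M n) (y : Y m),
    ldiff M (erefl (n - 1)) c = 0 -> ldiff Y e y = p n c ->
    ldiff M e (fill e c y) = c
}.

Hypothesis s_uncurved : s -> uncurved Y.

(** [Y] over itself is the terminal filler algebra. *)
Definition base_model : fill_model :=
  @Model k fill_gens fill_op Y (fun n x => f n x) (fun n m o _ => o.2).

Lemma base_filler : @filler_algebra base_model f (curvedLie_id Y).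
Proof. by split. Qed.

Definition hom_to_base (M : fill_model) i p (H : @filler_algebra M i p) :
  model_hom M base_model.
Proof.
exists p => [n x|n m [e y] a] /=.
  by rewrite (fill_gen H) (fill_over H).
exact: fill_fill H _ _ e a y.
Defined.

(** The structure map to [Y] of the term model is its map to the terminal filler
    algebra. The conditional law passes to the term model because its premises
    are preserved by morphisms to filler algebras, and all of these lie over
    [Y] compatibly. *)
Lemma initial_filler_algebra :
  exists (Z : fill_model) (i : curvedLie_hom X Z) (p : curvedLie_hom Z Y),
    [/\ filler_algebra i p, generated Z
      & forall (M : fill_model) j q, @filler_algebra M j q ->
          inhabited (model_hom Z M)].
Proof.
pose Phi M := exists j q, @filler_algebra M j q.
pose Z := term_model Phi.
have PY : Phi base_model by exists f, (curvedLie_id Y); apply: base_filler.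
pose p := term_model_hom PY.
have genZ : generated Z by apply: term_model_generated.
have [i iE] : exists i : curvedLie_hom X Z, forall n x, i n x = model_gen Z x.
  apply: (hom_of_joint (F := fun n (x : X n) => model_gen Z x)).
  move=> n a b ab; apply: term_model_separated => M h [j [q H]].
  by apply: (ab M h j) => m x; rewrite model_fun_gen (fill_gen H).
exists Z, i, p; split=> //; last first.
  by move=> M j q H; constructor; apply: term_model_hom; exists j, q.
split.
- by move=> n x; rewrite iE.
- by move=> n x; rewrite iE (model_fun_gen p).
- by move=> n m e c y; rewrite /fill (model_fun_op p).
- move=> ss; apply: term_model_separated => M h [j [q H]].
  by rewrite hom_curv linear0; apply: fill_curv H ss.
move=> ss n m e c y dc dy; apply: term_model_separated => M h [j [q H]].
rewrite hom_ldiff model_fun_op; apply: (fill_diff H ss).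
  by rewrite -hom_ldiff dc linear0.
rewrite dy.
pose p' := hom_to_base H.
have g_gen l (x : fill_gens l) :
    curvedLie_comp p' h l (model_gen Z x) = model_gen base_model x.
  by rewrite -[LHS]/(p' l (h l (model_gen Z x))) !model_fun_gen.
have g_op l l' (o : fill_op l l') b :
    curvedLie_comp p' h l' (@model_op _ _ _ Z l l' o b) =
    @model_op _ _ _ base_model l l' o (curvedLie_comp p' h l b).
  by rewrite -[LHS]/(p' l' (h l' (@model_op _ _ _ Z l l' o b))) !model_fun_op.
pose g := @ModelHom _ _ _ Z base_model _ g_gen g_op.
exact: (generated_hom_eq p g genZ).
Qed.

End FillerAlgebra.

(** * The lifting property of initial filler algebras *)

Section Pullback.
Variables (k : fieldType) (Z E B : curvedLie k).
Variables (v : curvedLie_hom Z B) (q : curvedLie_hom E B).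

Let A (b : bool) : curvedLie k := if b then Z else E.
Let S n (a : forall b, A b n) : Prop := v n (a true) = q n (a false).

Lemma pullback_exists :
  exists (P : curvedLie k) (p1 : curvedLie_hom P Z) (p2 : curvedLie_hom P E),
  [/\ forall n (a b : P n), p1 n a = p1 n b -> p2 n a = p2 n b -> a = b,
      forall n (a : P n), v n (p1 n a) = q n (p2 n a),
      forall n z e, v n z = q n e -> exists2 a : P n, p1 n a = z & p2 n a = e
    & forall (X : curvedLie k) (x1 : curvedLie_hom X Z)
          (x2 : curvedLie_hom X E), (forall n x, v n (x1 n x) = q n (x2 n x)) ->
        exists h : curvedLie_hom X P,
          (forall n x, p1 n (h n x) = x1 n x) /\
          (forall n x, p2 n (h n x) = x2 n x)].
Proof.
have clS : @subproduct_closed k bool A S.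
  split; rewrite /S.
  - by move=> n; rewrite !linear0.
  - by move=> n a b Sa Sb; rewrite !linearD Sa Sb.
  - by move=> n c a Sa; rewrite !linearZ /= Sa.
  - by move=> i j n e a b Sa Sb; rewrite !hom_br Sa Sb.
  - by move=> i j e a Sa; rewrite !hom_ldiff Sa.
  - by rewrite !hom_curv.
have [P [p [p_inj pS p_surj]]] := subproduct_exists clS.
exists P, (p true), (p false); split.
- by move=> n a b ab1 ab2; apply: p_inj => -[].
- exact: pS.
- move=> n z e ze.
  pose a b : A b n := if b as b0 return A b0 n then z else e.
  by have [c pc] := p_surj n a ze; exists c; rewrite pc.
- move=> X x1 x2 x12.
  pose x b : curvedLie_hom X (A b) :=
    if b as b0 return curvedLie_hom X (A b0) then x1 else x2.
  have [n y|h hp] := subproduct_lift p_inj (f := x).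
    exact: p_surj (fun b => x b n y) (x12 n y).
  by exists h; split=> n y; rewrite hp.
Qed.

End Pullback.

(** For surjections of dg Lie algebras this characterizes acyclic fibrations: it
    is the lifting property against the maps that adjoin a generator with
    prescribed differential. *)
Definition fills (k : fieldType) (E B : curvedLie k)
    (q : curvedLie_hom E B) : Prop :=
  forall n m (e : m - 1 = n) (c : E n) (b : B m),
    ldiff E (erefl (n - 1)) c = 0 -> ldiff B e b = q n c ->
    exists2 a : E m, ldiff E e a = c & q m a = b.

(** The pullback [P] of [q] along [v] is a filler algebra: a filler in [Z] is
    completed to one in [P] by solving a filling problem for [q]. Initiality
    gives a map [Z -> P] whose composite with the projection to [Z] is an
    endomorphism of the initial object, hence the identity. *)
Lemma initial_filler_lift (k : fieldType) (X Y : curvedLie k)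
    (f : curvedLie_hom X Y) (s : Prop) (Z : fill_model X Y)
    (i : curvedLie_hom X Z) (p : curvedLie_hom Z Y)
    (E B : curvedLie k) (q : curvedLie_hom E B) (u : curvedLie_hom X E)
    (v : curvedLie_hom Z B) :
  filler_algebra f s i p -> generated Z ->
  (forall (M : fill_model X Y) j r, filler_algebra f s (M := M) j r ->
    inhabited (model_hom Z M)) ->
  (forall n x, q n (u n x) = v n (i n x)) ->
  (forall n y, exists x, q n x = y) -> (s -> uncurved E) -> (s -> fills q) ->
  exists h : curvedLie_hom Z E,
    (forall n x, h n (i n x) = u n x) /\ (forall n z, q n (h n z) = v n z).
Proof.
move=> HZ genZ iniZ sq q_surj s_curv s_fill.
have [P [p1 [p2 [p_inj pq p_surj p_lift]]]] := pullback_exists v q.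
have [n x|g [g1 g2]] := p_lift X i u; first by rewrite sq.
have ex_fill n m (o : fill_op Y n m) (c : P n) : exists a : P m,
    p1 m a = fill o.1 (p1 n c) o.2 /\
    (s -> ldiff P (erefl (n - 1)) c = 0 -> ldiff Y o.1 o.2 = p n (p1 n c) ->
      ldiff P o.1 a = c).
  case: o => e y /=; set z := fill e _ y.
  (* Where the premises of the conditional law fail, any lift of [z] will do. *)
  have [[ss [dc dy]]|no] := pselect (s /\ ldiff P (erefl (n - 1)) c = 0 /\
      ldiff Y e y = p n (p1 n c)); last first.
    have [x qx] := q_surj m (v m z).
    have [a a1 _] := p_surj m z x (esym qx).
    by exists a; split=> // ss dc dy; case: no.
  have dz : ldiff Z e z = p1 n c.
    by apply: (fill_diff HZ) => //; rewrite -hom_ldiff dc linear0.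
  have [||x dx qx] := s_fill ss n m e (p2 n c) (v m z).
  - by rewrite -hom_ldiff dc linear0.
  - by rewrite -hom_ldiff dz pq.
  have [a a1 a2] := p_surj m z x (esym qx).
  exists a; split=> // _ _ _; apply: p_inj.
    by rewrite hom_ldiff a1.
  by rewrite hom_ldiff a2.
pose op n m (o : fill_op Y n m) c := sval (cid (ex_fill n m o c)).
have opP n m o c := svalP (cid (ex_fill n m o c)).
pose M : fill_model X Y :=
  @Model k (fill_gens X) (fill_op Y) P (fun n x => g n x) op.
have HM : @filler_algebra k X Y f s M g (curvedLie_comp p p1).
  split.
  - by [].
  - by move=> n x; rewrite /= g1 (fill_over HZ).
  - by move=> n m e c y; have [/= -> _] := opP n m (e, y) c;
      rewrite (fill_fill HZ).
  - move=> ss; apply: p_inj; rewrite hom_curv linear0.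
      exact: fill_curv HZ ss.
    exact: s_curv.
  - by move=> ss n m e c y dc dy; have [_ ->] := opP n m (e, y) c.
have [h] := iniZ M g _ HM.
pose h1 := curvedLie_comp p1 h.
have h1_gen n (x : fill_gens X n) : h1 n (model_gen Z x) = model_gen Z x.
  rewrite -[LHS]/(p1 n (h n (model_gen Z x))) model_fun_gen.
  by rewrite -[LHS]/(p1 n (g n x)) g1 (fill_gen HZ).
have h1_op n m (o : fill_op Y n m) c :
    h1 m (@model_op _ _ _ Z n m o c) = @model_op _ _ _ Z n m o (h1 n c).
  rewrite -[LHS]/(p1 m (h m (@model_op _ _ _ Z n m o c))) model_fun_op.
  by have [-> _] := opP n m o (h n c); case: o.
have h1E n a : p1 n (h n a) = a.
  exact: (generated_endo (@ModelHom _ _ _ Z Z h1 h1_gen h1_op) genZ).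
exists (curvedLie_comp p2 h); split=> n x /=.
  rewrite -(fill_gen HZ) (model_fun_gen h).
  exact: g2.
by rewrite -pq h1E.
Qed.

(** * Quasi-isomorphisms in terms of cycles and boundaries *)

Lemma br0l (k : fieldType) (A : gradedLie k) (i j n : int) (e : i + j = n)
    (b : A j) : br e (0 : A i) b = 0.
Proof. by have := linear0 (linear_of (br_linearl e b)). Qed.

Section QuasiIsomorphism.
Variable k : fieldType.
Implicit Types A B : curvedLie k.

Lemma cyclesP A n m (e : n - 1 = m) (z : A n) :
  cycles A n z <-> ldiff A e z = 0.
Proof. by subst m. Qed.

Lemma boundariesP A n m (e : m - 1 = n) (z : A n) :
  boundaries A n z <-> exists a, ldiff A e a = z.
Proof.
have em : m = n + 1 by rewrite -e subrK.
subst m; rewrite (eq_irrelevance e (addrK 1 n)).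
by split=> [[a _ <-]|[a <-]]; exists a.
Qed.

Lemma boundaries0 A n : boundaries A n 0.
Proof. by exists 0; rewrite ?linear0. Qed.

Lemma boundariesD A n (a b : A n) :
  boundaries A n a -> boundaries A n b -> boundaries A n (a + b).
Proof. by move=> [x _ <-] [y _ <-]; exists (x + y); rewrite ?linearD. Qed.

Lemma boundariesZ A n c (a : A n) :
  boundaries A n a -> boundaries A n (c *: a).
Proof. by move=> [x _ <-]; exists (c *: x); rewrite ?linearZ. Qed.

Lemma boundariesB A n (a b : A n) :
  boundaries A n a -> boundaries A n b -> boundaries A n (a - b).
Proof.
by move=> Ba Bb; rewrite -[- b]scaleN1r; apply/boundariesD/boundariesZ.
Qed.

Lemma homology_class_eq A n (a b : A n) :
  homology_class a = homology_class b <-> boundaries A n (a - b).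
Proof.
split=> [ab|Bab].
  have : homology_class a a by exists 0; [apply: boundaries0|rewrite addr0].
  by rewrite ab => -[x Bx <-]; rewrite [b + x]addrC addrK.
apply/seteqP; split=> _ [x Bx <-].
  by exists (a - b + x); [apply: boundariesD|rewrite addrA subrKC].
exists (x - (a - b)); first exact: boundariesB.
by rewrite opprB addrCA [a + _]addrC subrK addrC.
Qed.

Lemma quasi_isomorphismP A B (f : curvedLie_hom A B) :
  quasi_isomorphism f <-> forall n,
    (forall z : A n, cycles A n z -> boundaries B n (f n z) ->
      boundaries A n z) /\
    (forall y : B n, cycles B n y -> exists2 z : A n,
      cycles A n z & boundaries B n (y - f n z)).
Proof.
have f_cyc n (z : A n) : cycles A n z -> cycles B n (f n z).
  by rewrite /cycles /= -hom_ldiff => ->; rewrite linear0.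
split=> qf n.
  have [_ f_inj f_surj] := qf n; split=> [z Zz Bz|y Zy].
    have /homology_class_eq : homology_class z = homology_class (0 : A n).
      apply: f_inj; rewrite ?inE; [by exists z|exists 0 => //|].
        by rewrite /cycles /= linear0.
      by rewrite !homology_map_class homology_class_eq linear0 subr0.
    by rewrite subr0.
  have [|_ [z Zz <-]] := f_surj (homology_class y); first by exists y.
  by rewrite homology_map_class => /esym/homology_class_eq; exists z.
have [f_inj f_surj] := qf n; split.
- move=> _ [z Zz <-]; rewrite homology_map_class.
  by exists (f n z) => //; apply: f_cyc.
- move=> c c'; rewrite !inE => -[z Zz <-] [z' Zz' <-].
  rewrite !homology_map_class => /homology_class_eq.
  rewrite -linearB => Bzz'; apply/homology_class_eq; apply: f_inj => //.
  by move: Zz Zz'; rewrite /cycles /= linearB => -> ->; rewrite subr0.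
- move=> _ [y Zy <-]; have [z Zz Byz] := f_surj y Zy.
  exists (homology_class z); first by exists z.
  by rewrite homology_map_class; apply/esym/homology_class_eq.
Qed.

(** If [q c] bounds then [c = d a0], and the error [b - q a0] is a cycle. Up to
    a boundary it is the image of a cycle [z], and boundaries lift along the
    surjection [q]; adding both corrections to [a0] gives the filler. *)
Lemma fills_of_quasi_isomorphism A B (q : curvedLie_hom A B) :
  uncurved A -> (forall n y, exists x, q n x = y) -> quasi_isomorphism q ->
  fills q.
Proof.
move=> A0 q_surj /quasi_isomorphismP qi n m e c b dc db.
have [a0 da0] : exists a, ldiff A e a = c.
  have [qi_inj _] := qi n.
  apply/(boundariesP e)/qi_inj; first exact/cyclesP.
  by apply/(boundariesP e); exists b.
have [_ qi_surj] := qi m.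
have [|z Zz] := qi_surj (b - q m a0).
  by apply/(cyclesP e); rewrite linearB db -hom_ldiff da0 subrr.
move=> [b' _ db']; have [a' qa'] := q_surj _ b'.
exists (a0 + z + ldiff A (addrK 1 m) a').
  rewrite !linearD /= da0 (cyclesP e z).1 // addr0.
  have ew : - 2%:Z + (m + 1) = n by rewrite -e addrC -addrA.
  by rewrite (ldiff_ldiff _ _ ew) A0 br0l addr0.
rewrite !linearD /= hom_ldiff qa' db' -addrA [X in _ + X]addrC subrK.
by rewrite addrC subrK.
Qed.

(** Injectivity in homology is filling over an element that bounds the image;
    surjectivity is filling with [c = 0]. *)
Lemma quasi_isomorphism_of_fills A B (q : curvedLie_hom A B) :
  (forall n y, exists x, q n x = y) -> fills q -> quasi_isomorphism q.
Proof.
move=> q_surj q_fill; apply/quasi_isomorphismP => n; split=> [z Zz|y Zy].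
  move=> /(boundariesP (addrK 1 n)) [b db].
  have [a da _] := q_fill _ _ (addrK 1 n) z b Zz db.
  by apply/(boundariesP (addrK 1 n)); exists a.
have [||a da qa] := q_fill _ _ (erefl (n - 1)) 0 y.
- by rewrite linear0.
- by rewrite linear0.
by exists a => //; rewrite qa subrr; apply: boundaries0.
Qed.

End QuasiIsomorphism.

(** * The first-order thickening of a curved Lie algebra *)

Section Sign.
Variable k : fieldType.
Implicit Types i j : int.

Lemma signD i j : (-1) ^ (i + j) = (-1) ^ i * (-1) ^ j :> k.
Proof. by rewrite expfzDr // oppr_eq0 oner_eq0. Qed.

Lemma signMM i : (-1) ^ i * (-1) ^ i = 1 :> k.
Proof. by rewrite -expfzMl mulrNN mulr1 exp1rz. Qed.

Lemma signS i : (-1) ^ (i + 1) = - (-1) ^ i :> k.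
Proof. by rewrite signD expr1z mulrN1. Qed.

Lemma signP i : (-1) ^ (i - 1) = - (-1) ^ i :> k.
Proof. by rewrite -[in RHS](subrK 1 i) signS opprK. Qed.

Lemma signMSl i j : (-1) ^ ((i + 1) * j) = (-1) ^ (i * j) * (-1) ^ j :> k.
Proof. by rewrite mulrDl mul1r signD. Qed.

Lemma signMSr i j : (-1) ^ (i * (j + 1)) = (-1) ^ (i * j) * (-1) ^ i :> k.
Proof. by rewrite mulrDr mulr1 signD. Qed.

End Sign.

Section Bilinear.
Variables (k : fieldType) (A : gradedLie k).
Variables (i j n : int) (e : i + j = n).

Lemma brDl (a a' : A i) (b : A j) : br e (a + a') b = br e a b + br e a' b.
Proof. exact: (linearD (linear_of (br_linearl e b))). Qed.

Lemma brZl c (a : A i) (b : A j) : br e (c *: a) b = c *: br e a b.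
Proof. exact: (linearZ_LR (linear_of (br_linearl e b))). Qed.

Lemma brDr (a : A i) (b b' : A j) : br e a (b + b') = br e a b + br e a b'.
Proof. exact: (linearD (linear_of (br_linearr e a))). Qed.

Lemma brZr c (a : A i) (b : A j) : br e a (c *: b) = c *: br e a b.
Proof. exact: (linearZ_LR (linear_of (br_linearr e a))). Qed.

Lemma br0r (a : A i) : br e a (0 : A j) = 0.
Proof. exact: (linear0 (linear_of (br_linearr e a))). Qed.

Lemma brNl (a : A i) (b : A j) : br e (- a) b = - br e a b.
Proof. by rewrite -scaleN1r brZl scaleN1r. Qed.

Lemma brNr (a : A i) (b : A j) : br e a (- b) = - br e a b.
Proof. by rewrite -scaleN1r brZr scaleN1r. Qed.

End Bilinear.

(** The differential of the thickening contains a component that does not change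
    the element but only the expression for its degree, [i = (i - 1) + 1]. *)
Definition recast (k : fieldType) (A : gradedLie k) (i j : int) (e : i = j)
  (a : A i) : A j := eq_rect i (fun n => A n) a j e.

Section Recast.
Variables (k : fieldType) (A : curvedLie k).

Lemma recast_linear i j (e : i = j) : linear (recast (A := A) e).
Proof. by subst j. Qed.

Lemma recastD i j (e : i = j) (a b : A i) :
  recast e (a + b) = recast e a + recast e b.
Proof. by subst j. Qed.

Lemma recast0 i j (e : i = j) : recast e (0 : A i) = 0.
Proof. by subst j. Qed.

Lemma recastK i j (e : i = j) (e' : j = i) (a : A i) :
  recast e' (recast e a) = a.
Proof. by subst j; rewrite (eq_irrelevance e' erefl). Qed.

Lemma recast_diff (i j j' : int) (e : i - 1 = j) (ej : j = j') (e' : i - 1 = j')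
  (a : A i) : recast ej (ldiff A e a) = ldiff A e' a.
Proof. by subst j'; rewrite (eq_irrelevance e e'). Qed.

Lemma diff_recast (i i' j : int) (ei : i = i') (e : i' - 1 = j) (e' : i - 1 = j)
  (a : A i) : ldiff A e (recast ei a) = ldiff A e' a.
Proof. by subst i'; rewrite (eq_irrelevance e e'). Qed.

Lemma recast_br (i j n n' : int) (e : i + j = n) (en : n = n')
  (e' : i + j = n') (a : A i) (b : A j) : recast en (br e a b) = br e' a b.
Proof. by subst n'; rewrite (eq_irrelevance e e'). Qed.

Lemma br_recastl (i i' j n : int) (ei : i = i') (e : i' + j = n)
  (e' : i + j = n) (a : A i) (b : A j) : br e (recast ei a) b = br e' a b.
Proof. by subst i'; rewrite (eq_irrelevance e e'). Qed.

Lemma br_recastr (i j j' n : int) (ej : j = j') (e : i + j' = n)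
  (e' : i + j = n) (a : A i) (b : A j) : br e a (recast ej b) = br e' a b.
Proof. by subst j'; rewrite (eq_irrelevance e e'). Qed.

End Recast.

Section Thickening.
Variables (k : fieldType) (A : curvedLie k).

(** The triple [(a0, a1, a2)] stands for [a0 + t a1 + dt a2] in the tensor
    product of [A] with the quotient of [k[t, dt]] by [t^2] and [t dt], where
    [t] has degree 0 and [dt] degree -1. Morphisms [A -> thickening A] with
    first component the identity are pairs of a derivation [D] of degree 0 and
    a derivation [h] of degree 1 with [D = dh + hd]. *)
Definition thick_mod (n : int) : lmodType k := (A n * A n * A (n + 1)%R)%type.

Lemma deg_shl (i j n : int) : i + j = n -> i + 1 + j = n + 1.
Proof. by move=> <-; rewrite addrAC. Qed.

Lemma deg_shr (i j n : int) : i + j = n -> i + (j + 1) = n + 1.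
Proof. by move=> <-; rewrite addrA. Qed.

Lemma deg_pred (i j : int) : i - 1 = j -> i = j + 1.
Proof. by move=> <-; rewrite subrK. Qed.

Definition thick_br (i j n : int) (e : i + j = n) (a : thick_mod i)
    (b : thick_mod j) : thick_mod n :=
  (br e a.1.1 b.1.1, br e a.1.1 b.1.2 + br e a.1.2 b.1.1,
   br (deg_shl e) a.2 b.1.1 + (-1) ^ i *: br (deg_shr e) a.1.1 b.2).

Definition thick_diff (i j : int) (e : i - 1 = j) (a : thick_mod i) :
    thick_mod j :=
  (ldiff A e a.1.1, ldiff A e a.1.2,
   recast (deg_pred e) a.1.2 - ldiff A (deg_shl e) a.2).

Lemma thick_eq n (a b : thick_mod n) :
  a.1.1 = b.1.1 -> a.1.2 = b.1.2 -> a.2 = b.2 -> a = b.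
Proof. by case: a b => [[a0 a1] a2] [[b0 b1] b2] /= -> -> ->. Qed.

Let thick_linl (i j n : int) (e : i + j = n) (b : thick_mod j) :
  linear (fun a => thick_br e a b).
Proof.
move=> c u v; apply: thick_eq => /=; rewrite !(brDl, brZl) //.
  by rewrite scalerDr addrACA.
by rewrite !scalerDr !scalerA mulrC addrACA.
Qed.

Let thick_linr (i j n : int) (e : i + j = n) (a : thick_mod i) :
  linear (thick_br e a).
Proof.
move=> c u v; apply: thick_eq => /=; rewrite !(brDr, brZr) //.
  by rewrite scalerDr addrACA.
by rewrite !scalerDr !scalerA mulrC addrACA.
Qed.

(* Up to sign, the third component of each axiom is the sum of instances of the
   same axiom in [A] in which one argument has its degree raised by one. *)
Let thick_anti (i j n : int) (e : i + j = n) (e' : j + i = n)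
    (a : thick_mod i) (b : thick_mod j) :
  thick_br e a b = - ((-1) ^ (i * j) *: thick_br e' b a).
Proof.
apply: thick_eq => /=.
- exact: br_antisym.
- by rewrite scalerDr opprD -!br_antisym [LHS]addrC.
- rewrite (br_antisym (deg_shl e) (deg_shr e')).
  rewrite (br_antisym (deg_shr e) (deg_shl e')).
  rewrite signMSl signMSr scalerN scalerA mulrCA signMM mulr1.
  by rewrite scalerDr opprD scalerA [LHS]addrC.
Qed.

Let thick_jac (i j l ij jl il n : int)
    (eij : i + j = ij) (ejl : j + l = jl) (eil : i + l = il)
    (e1 : i + jl = n) (e2 : ij + l = n) (e3 : j + il = n)
    (a : thick_mod i) (b : thick_mod j) (c : thick_mod l) :
  thick_br e1 a (thick_br ejl b c) = thick_br e2 (thick_br eij a b) c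
    + (-1) ^ (i * j) *: thick_br e3 b (thick_br eil a c).
Proof.
apply: thick_eq => /=.
- exact: br_jacobi.
- rewrite !(brDl, brDr) !(br_jacobi eij ejl eil e1 e2 e3) !scalerDr.
  by rewrite [LHS](AC (2*2*2) ((1*(3*5))*((2*6)*4))) /=.
- rewrite !(brDl, brDr, brZl, brZr) !scalerDr.
  rewrite (br_jacobi (deg_shl eij) ejl (deg_shl eil) (deg_shl e1)
    (deg_shl e2) (deg_shr e3)).
  rewrite (br_jacobi (deg_shr eij) (deg_shl ejl) eil (deg_shr e1)
    (deg_shl e2) (deg_shl e3)).
  rewrite (br_jacobi eij (deg_shr ejl) (deg_shr eil) (deg_shr e1)
    (deg_shr e2) (deg_shr e3)).
  have sij : (-1) ^ ij = (-1) ^ i * (-1) ^ j :> k by rewrite -eij signD.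
  rewrite !scalerDr !scalerA sij signMSl signMSr.
  rewrite (mulrCA ((-1) ^ i)) signMM mulr1.
  rewrite [LHS](AC (2*(2*2)) (((1*3)*5)*(4*(2*6)))) /=.
  by do 3 congr (_ + _); rewrite mulrC -mulrA [X in _ * X]mulrC.
Qed.

Definition thick_graded : gradedLie k :=
  @GradedLie k thick_mod thick_br thick_linl thick_linr thick_anti thick_jac.

Let thick_diff_linear (i j : int) (e : i - 1 = j) : linear (thick_diff e).
Proof.
move=> c u v; apply: thick_eq => /=; [exact: linearP|exact: linearP|].
by rewrite recast_linear linearD linearZ /= opprD scalerBr addrACA.
Qed.

Definition thickening : curvedLie k.
Proof.
exists thick_graded (fun i j e => linear_of (thick_diff_linear e))
  (curv A, 0, 0).
- move=> i j n i' j' n' e ei ej en e1 e2 a b; apply: thick_eq => /=.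
  + exact: ldiff_br.
  + rewrite linearD /= !(ldiff_br e ei ej en e1 e2) scalerDr.
    by rewrite [LHS](AC (2*2) ((1*3)*(2*4))).
  + rewrite linearD linearZ /=.
    rewrite (ldiff_br (deg_shl e) (deg_shl ei) ej (deg_shl en) (deg_shl e1)
      (deg_shl e2)).
    rewrite (ldiff_br (deg_shr e) ei (deg_shl ej) (deg_shl en) (deg_shr e1)
      (deg_shr e2)).
    rewrite !(brDl, brDr, brNl, brNr).
    have -> : (-1) ^ i' = - (-1) ^ i :> k by rewrite -ei signP.
    have eni : i + j = n' + 1 by rewrite e; exact: deg_pred.
    rewrite recastD !(recast_br e (deg_pred en) eni).
    rewrite (br_recastl (deg_pred ei) (deg_shl e1) eni).
    rewrite (br_recastr (deg_pred ej) (deg_shr e2) eni) signS.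
    rewrite !(scalerDr, scalerN, scaleNr, scalerA, signMM, scale1r).
    rewrite !(opprD, opprK).
    by rewrite [LHS](AC (2*(2*2)) (((2*3)*5)*(4*(1*6)))).
- move=> i j n e e' ew a; apply: thick_eq => /=.
  + exact: ldiff_ldiff.
  + by rewrite (ldiff_ldiff e e' ew) br0l addr0.
  + have ein : i - 1 = n + 1 := etrans e (deg_pred e').
    rewrite linearB /= (recast_diff e (deg_pred e') ein).
    rewrite (diff_recast (deg_pred e) (deg_shl e') ein) opprB subrKC.
    rewrite (ldiff_ldiff (deg_shl e) (deg_shl e') (deg_shr ew)) br0l add0r.
    have -> : (-1) ^ (- 2%:Z) = 1 :> k by rewrite (signD k (-1) (-1)) signMM.
    by rewrite scale1r.
- move=> n e; apply: thick_eq => /=.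
  + exact: ldiff_curv.
  + exact: linear0.
  + by rewrite linear0 subr0 recast0.
Defined.

Let const_linear n : linear (fun a : A n => (a, 0, 0) : thickening n).
Proof. by move=> c u v; apply: thick_eq; rewrite /= ?scaler0 ?addr0. Qed.

Definition thick_const : curvedLie_hom A thickening.
Proof.
exists (fun n => linear_of (@const_linear n)) => [i j n e a b|i j e a|//].
  by apply: thick_eq; rewrite //= ?br0l ?br0r ?scaler0 ?addr0.
by apply: thick_eq; rewrite //= ?recast0 linear0 ?subr0.
Defined.

Let proj_linear n : linear (fun a : thickening n => a.1.1).
Proof. by []. Qed.

Definition thick_proj : curvedLie_hom thickening A.
Proof. by exists (fun n => linear_of (@proj_linear n)). Defined.

End Thickening.

(** * The derivation counting free generators *)

Section WeightDerivation.
Variables (k : fieldType) (X Y : curvedLie k) (f : curvedLie_hom X Y).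
Variables (Z : fill_model X Y) (i : curvedLie_hom X Z) (p : curvedLie_hom Z Y).
Hypotheses (HZ : filler_algebra f False i p) (genZ : generated Z).
Hypothesis iniZ : forall (M : fill_model X Y) j r,
  filler_algebra f False (M := M) j r -> inhabited (model_hom Z M).

(** The thickening of [Z] becomes a filler algebra with [X] embedded by
    constants and the filler of [c] and [y] given by [(1 + t) fill c0 y], where
    [c0] is the constant coefficient of [c]. Initiality yields a map from [Z]
    whose coefficient of [t] is [D]; the coefficient of [dt] is the contraction
    that makes [D] vanish in homology. *)
Lemma weight_derivation : exists D : forall n, {linear Z n -> Z n},
  [/\ forall (l m n : int) (e : l + m = n) a b,
        D n (br e a b) = br e a (D m b) + br e (D l a) b,
      forall (l m : int) (e : l - 1 = m) a,
        D m (ldiff Z e a) = ldiff Z e (D l a),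
      forall n x, D n (i n x) = 0,
      forall n m (e : m - 1 = n) c y, D m (fill e c y) = fill e c y :> Z m
    & forall n a, cycles Z n a -> boundaries Z n (D n a)].
Proof.
pose T := thickening Z.
pose op n m (o : fill_op Y n m) (c : T n) : T m :=
  (fill o.1 c.1.1 o.2, fill o.1 c.1.1 o.2, 0).
pose j := curvedLie_comp (thick_const Z) i.
pose M : fill_model X Y :=
  @Model k (fill_gens X) (fill_op Y) T (fun n x => j n x) op.
have HM : filler_algebra f False (M := M) j (curvedLie_comp p (thick_proj Z)).
  split=> //.
  - by move=> n x; exact: (fill_over HZ).
  - by move=> n m e c y; exact: (fill_fill HZ).
have [g] := iniZ HM.
pose g0 := curvedLie_comp (thick_proj Z) g.
have g_gen n (x : fill_gens X n) : g n (model_gen Z x) = (i n x, 0, 0).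
  by rewrite model_fun_gen.
have g_op n m (o : fill_op Y n m) c : g m (@model_op _ _ _ Z n m o c) =
    (fill o.1 (g n c).1.1 o.2, fill o.1 (g n c).1.1 o.2, 0).
  by rewrite model_fun_op.
have g0_gen n (x : fill_gens X n) : g0 n (model_gen Z x) = model_gen Z x.
  by rewrite -[LHS]/(g n (model_gen Z x)).1.1 g_gen (fill_gen HZ).
have g0_op n m (o : fill_op Y n m) c :
    g0 m (@model_op _ _ _ Z n m o c) = @model_op _ _ _ Z n m o (g0 n c).
  rewrite -[LHS]/(g m (@model_op _ _ _ Z n m o c)).1.1 g_op.
  by case: o.
have gE n a : (g n a).1.1 = a.
  exact: (generated_endo (@ModelHom _ _ _ Z Z g0 g0_gen g0_op) genZ).
have D_lin n : linear (fun a : Z n => (g n a).1.2).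
  by move=> c a b; rewrite linearP.
exists (fun n => linear_of (D_lin n)); split=> /=.
- by move=> l m n e a b; rewrite hom_br /= !gE.
- by move=> l m e a; rewrite hom_ldiff.
- by move=> n x; rewrite -(fill_gen HZ) g_gen.
- by move=> n m e c y; rewrite g_op /= gE.
- move=> n a Za.
  have := hom_ldiff g (erefl (n - 1)) a.
  rewrite Za linear0 => /(congr1 snd) /= /esym/eqP.
  rewrite subr_eq0 => /eqP dh.
  apply/(boundariesP (addrK 1 n)).
  exists (g n a).2.
  rewrite -(recast_diff (deg_shl (erefl (n - 1))) (subrK 1 n)) -dh.
  exact: recastK.
Qed.

End WeightDerivation.

(** * Free extensions of uncurved algebras are quasi-isomorphisms *)

Lemma terminal_exists (k : fieldType) : exists T : curvedLie k,
  (forall n (a b : T n), a = b) /\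
  forall X : curvedLie k, inhabited (curvedLie_hom X T).
Proof.
pose A (j : void) : curvedLie k := match j with end.
have clS : @subproduct_closed k void A (fun _ _ => True) by [].
have [T [p [p_inj _ p_surj]]] := subproduct_exists clS.
exists T; split=> [n a b|X]; first by apply: p_inj => -[].
pose f j : curvedLie_hom X (A j) := match j with end.
have [n x|h _] := subproduct_lift p_inj (f := f); last by constructor.
by apply: (p_surj n (fun j => f j n x)).
Qed.

Section FreeExtensionAcyclic.
Variables (k : fieldType) (X Y : curvedLie k) (f : curvedLie_hom X Y).
Variables (Z : fill_model X Y) (i : curvedLie_hom X Z) (p : curvedLie_hom Z Y).
Hypotheses (HZ : filler_algebra f False i p) (genZ : generated Z).
Hypothesis iniZ : forall (M : fill_model X Y) j r,
  filler_algebra f False (M := M) j r -> inhabited (model_hom Z M).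

(** Lift the identity of [X] against the map from [X] to the zero algebra. *)
Lemma retraction_exists :
  exists r : curvedLie_hom Z X, forall n x, r n (i n x) = x.
Proof.
have [T [T_eq T_hom]] := terminal_exists k.
have [q] := T_hom X; have [v] := T_hom Z.
have [||||r [r1 _]] := initial_filler_lift (q := q) (u := curvedLie_id X)
  (v := v) HZ genZ iniZ.
- by move=> n x; apply: T_eq.
- by move=> n y; exists 0; apply: T_eq.
- by [].
- by [].
by exists r.
Qed.

Variable D : forall n, {linear Z n -> Z n}.
Arguments D {n}.
Hypothesis D_br : forall (l m n : int) (e : l + m = n) (a : Z l) (b : Z m),
  D (br e a b) = br e a (D b) + br e (D a) b.
Hypothesis D_diff : forall (l m : int) (e : l - 1 = m) (a : Z l),
  D (ldiff Z e a) = ldiff Z e (D a).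
Hypothesis D_base : forall n x, D (i n x) = 0.
Hypothesis D_fill : forall n m (e : m - 1 = n) (c : Z n) (y : Y m),
  D (fill e c y) = fill e c y.
Hypothesis D_null : forall n (a : Z n), cycles Z n a -> boundaries Z n (D a).

(** Sums of an element of [X] and of eigenvectors of [D] for positive integer
    eigenvalues. Weights add under brackets, so these form a subalgebra closed
    under fillers, which is all of [Z]. *)
Inductive weight_sum n : Z n -> Prop :=
| WeightZero x : weight_sum (i n x)
| WeightAdd a b of weight_sum a & weight_sum b : weight_sum (a + b)
| WeightPos m a of D a = m.+1%:R *: a : weight_sum a.

Lemma weight_sum_scale n c (a : Z n) : weight_sum a -> weight_sum (c *: a).
Proof.
elim=> {a} [x|a b _ IHa _ IHb|m a Da].
- by rewrite -linearZ; apply: WeightZero.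
- by rewrite scalerDr; apply: WeightAdd.
- by apply: (@WeightPos n m); rewrite linearZ /= Da !scalerA mulrC.
Qed.

Lemma weight_sum_br (l m n : int) (e : l + m = n) (a : Z l) (b : Z m) :
  weight_sum a -> weight_sum b -> weight_sum (br e a b).
Proof.
move=> wa; elim: wa b => {a} [x|a a' _ IHa _ IHa'|d a Da] b.
- elim=> {b} [y|b b' _ IHb _ IHb'|d b Db].
  + by rewrite -hom_br; apply: WeightZero.
  + by rewrite brDr; apply: WeightAdd.
  + by apply: (@WeightPos _ d); rewrite D_br D_base Db br0l addr0 brZr.
- by move=> wb; rewrite brDl; apply: WeightAdd; [apply: IHa|apply: IHa'].
- elim=> {b} [y|b b' _ IHb _ IHb'|d' b Db].
  + by apply: (@WeightPos _ d); rewrite D_br D_base Da br0r add0r brZl.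
  + by rewrite brDr; apply: WeightAdd.
  + apply: (@WeightPos _ (d' + d.+1)%N).
    by rewrite D_br Da Db brZl brZr -scalerDl -natrD addSn.
Qed.

Lemma weight_sum_all n (a : Z n) : weight_sum a.
Proof.
move: n a; apply: genZ; split.
- by move=> n; rewrite -(linear0 (i n)); apply: WeightZero.
- by move=> n a b; apply: WeightAdd.
- by move=> n c a; apply: weight_sum_scale.
- by move=> l m n e a b; apply: weight_sum_br.
- move=> l m e a; elim=> {a} [x|a b _ IHa _ IHb|d a Da].
  + by rewrite -hom_ldiff; apply: WeightZero.
  + by rewrite linearD; apply: WeightAdd.
  + by apply: (@WeightPos _ d); rewrite D_diff Da linearZ.
- by rewrite -(hom_curv i); apply: WeightZero.
- by move=> n x; rewrite (fill_gen HZ); apply: WeightZero.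
- move=> n m [e y] a _; apply: (@WeightPos _ 0).
  by rewrite scale1r; apply: D_fill.
Qed.

(** The operator [(D - N) ... (D - 1)]. It kills weights from 1 to [N], while on
    the homology of [Z], where [D] is zero, and on [X] it is multiplication by
    the nonzero scalar [(-1)^N N!]. Comparing the two isolates the part in [X]
    of a cycle. *)
Fixpoint kill_weights N n (a : Z n) : Z n :=
  if N is M.+1 then D (kill_weights M a) - M.+1%:R *: kill_weights M a else a.

Lemma kill_weightsD N n (a b : Z n) :
  kill_weights N (a + b) = kill_weights N a + kill_weights N b.
Proof.
by elim: N => //= N ->; rewrite linearD scalerDr opprD addrACA.
Qed.

Lemma kill_weights0 N n : kill_weights N (0 : Z n) = 0.
Proof. by elim: N => //= N ->; rewrite linear0 scaler0 subr0. Qed.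

Lemma kill_weightsN N n (a : Z n) : kill_weights N (- a) = - kill_weights N a.
Proof. by apply/eqP; rewrite -addr_eq0 -kill_weightsD addNr kill_weights0. Qed.

Lemma kill_weights_diff N (l m : int) (e : l - 1 = m) (a : Z l) :
  kill_weights N (ldiff Z e a) = ldiff Z e (kill_weights N a).
Proof.
elim: N => //= N ->.
by rewrite D_diff [RHS]linearB /= [ldiff Z e (_ *: _)]linearZ.
Qed.

Lemma kill_weights_eigen N n lam (a : Z n) : D a = lam *: a ->
  kill_weights N a = (\prod_(j < N) (lam - j.+1%:R)) *: a.
Proof.
move=> Da; elim: N => [|N IH] /=; first by rewrite big_ord0 scale1r.
rewrite IH linearZ /= Da !scalerA -scalerBl big_ord_recr /=.
by rewrite mulrBr [_%:R * _]mulrC.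
Qed.

Let unit_prod N : k := \prod_(j < N) (0 - j.+1%:R).

Lemma kill_weights_base N n x : kill_weights N (i n x) = unit_prod N *: i n x.
Proof. by apply: kill_weights_eigen; rewrite D_base scale0r. Qed.

Lemma kill_weights_cycle N n (a : Z n) : cycles Z n a ->
  boundaries Z n (kill_weights N a - unit_prod N *: a).
Proof.
move=> Za; elim: N => [|N IH] /=.
  rewrite /unit_prod big_ord0 scale1r subrr; exact: boundaries0.
have Zk : cycles Z n (kill_weights N a).
  by rewrite /cycles /= -kill_weights_diff Za kill_weights0.
rewrite /unit_prod big_ord_recr /= -/(unit_prod N) sub0r mulrN scaleNr opprK.
rewrite mulrC -scalerA -addrA [- _ + _]addrC -scalerBr.
apply: boundariesD; first exact: D_null.
rewrite -opprB scalerN -scaleNr; exact: boundariesZ.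
Qed.

Lemma kill_weights_exists n (a : Z n) :
  exists x N, forall M, (N <= M)%N -> kill_weights M (a - i n x) = 0.
Proof.
elim: (weight_sum_all a) => {a} [x|a b _ [x [N ax]] _ [y [N' bx]]|m a Da].
- by exists x, 0 => M _; rewrite subrr kill_weights0.
- exists (x + y), (maxn N N') => M; rewrite geq_max => /andP[NM N'M].
  by rewrite linearD opprD addrACA kill_weightsD ax // bx // addr0.
- exists 0, m.+1 => M mM; rewrite linear0 subr0 (kill_weights_eigen M Da).
  by rewrite (bigD1 (Ordinal mM)) //= subrr mul0r scale0r.
Qed.

Hypothesis k_char0 : [pchar k] =i pred0.
Hypothesis X_uncurved : uncurved X.

Lemma base_quasi_isomorphism : quasi_isomorphism i.
Proof.
have [r rK] := retraction_exists.
apply/quasi_isomorphismP => n; split=> [x Zx|a Za].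
  move=> /(boundariesP (addrK 1 n)) [b db]; apply/(boundariesP (addrK 1 n)).
  by exists (r (n + 1) b); rewrite -hom_ldiff db rK.
have [x [N kill_ax]] := kill_weights_exists a.
have B_ax : boundaries Z n (a - i n x).
  have prod_neq0 : unit_prod N != 0.
    apply/prodf_neq0 => j _; rewrite sub0r oppr_eq0.
    by rewrite ((pcharf0P k).1 k_char0).
  rewrite -[_ - _](scalerK prod_neq0); apply: boundariesZ.
  have /eqP := kill_ax N (leqnn N).
  rewrite kill_weightsD kill_weightsN kill_weights_base subr_eq0 => /eqP kill_a.
  rewrite scalerBr -kill_a -opprB -scaleN1r; apply: boundariesZ.
  exact: kill_weights_cycle.
exists x => //.
have d_ax : ldiff Z (erefl (n - 1)) (a - i n x) = 0.
  have [h <-] := (boundariesP (addrK 1 n) (a - i n x)).1 B_ax.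
  have ew : - 2%:Z + (n + 1) = n - 1 by rewrite addrCA.
  by rewrite (ldiff_ldiff _ _ ew) -(hom_curv i) X_uncurved linear0 br0l.
rewrite /cycles /= -[LHS]rK hom_ldiff.
move/eqP: d_ax; rewrite linearB subr_eq0 => /eqP <-.
by rewrite Za linear0.
Qed.

End FreeExtensionAcyclic.

(** * Weak equivalences and fibrations *)

Section WeakEquivalences.
Variable k : fieldType.

Lemma hom_uncurved (A B : curvedLie k) (f : curvedLie_hom A B) :
  uncurved A -> uncurved B.
Proof. by rewrite /uncurved -(hom_curv f) => ->; rewrite linear0. Qed.

Lemma hom_cycles (A B : curvedLie k) (f : curvedLie_hom A B) n (z : A n) :
  cycles A n z -> cycles B n (f n z).
Proof. by rewrite /cycles /= -hom_ldiff => ->; rewrite linear0. Qed.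

Lemma hom_boundaries (A B : curvedLie k) (f : curvedLie_hom A B) n (z : A n) :
  boundaries A n z -> boundaries B n (f n z).
Proof.
move=> [a _ <-]; rewrite hom_ldiff; apply/(boundariesP (addrK 1 n)).
by exists (f (n + 1) a).
Qed.

Lemma boundaries_sub_trans (A : curvedLie k) n (a b c : A n) :
  boundaries A n (a - b) -> boundaries A n (b - c) -> boundaries A n (a - c).
Proof. by move=> /boundariesD Bab /Bab; rewrite addrA subrK. Qed.

Lemma boundaries_sub_r (A : curvedLie k) n (a b : A n) :
  boundaries A n (a - b) -> boundaries A n b -> boundaries A n a.
Proof. by move=> /boundariesD Bab /Bab; rewrite subrK. Qed.

Lemma boundaries_sub_l (A : curvedLie k) n (a b : A n) :
  boundaries A n (a - b) -> boundaries A n a -> boundaries A n b.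
Proof. by move=> Bab /boundariesB /(_ Bab); rewrite subKr. Qed.

Section Composition.
Variables (A B C : curvedLie k) (f : curvedLie_hom A B) (g : curvedLie_hom B C).

Lemma quasi_isomorphism_comp : quasi_isomorphism f -> quasi_isomorphism g ->
  quasi_isomorphism (curvedLie_comp g f).
Proof.
move=> /quasi_isomorphismP qf /quasi_isomorphismP qg.
apply/quasi_isomorphismP => n; have [f_inj f_surj] := qf n.
have [g_inj g_surj] := qg n; split=> [z Zz Bz|y Zy].
  by apply: f_inj => //; apply: g_inj => //; apply: hom_cycles.
have [x Zx Byx] := g_surj y Zy; have [z Zz Bxz] := f_surj x Zx.
exists z => //; apply: boundaries_sub_trans Byx _.
by rewrite /= -linearB; apply: hom_boundaries.
Qed.

Lemma quasi_isomorphism_cancel_l : quasi_isomorphism f ->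
  quasi_isomorphism (curvedLie_comp g f) -> quasi_isomorphism g.
Proof.
move=> /quasi_isomorphismP qf /quasi_isomorphismP qgf.
apply/quasi_isomorphismP => n; have [f_inj f_surj] := qf n.
have [gf_inj gf_surj] := qgf n; split=> [y Zy By|y Zy].
  have [z Zz Byz] := f_surj y Zy.
  apply: (boundaries_sub_r Byz); apply/hom_boundaries/gf_inj => //.
  by have := hom_boundaries g Byz; rewrite linearB => /boundaries_sub_l/(_ By).
by have [z Zz Byz] := gf_surj y Zy; exists (f n z) => //; apply: hom_cycles.
Qed.

Lemma quasi_isomorphism_cancel_r : quasi_isomorphism g ->
  quasi_isomorphism (curvedLie_comp g f) -> quasi_isomorphism f.
Proof.
move=> /quasi_isomorphismP qg /quasi_isomorphismP qgf.
apply/quasi_isomorphismP => n; have [g_inj g_surj] := qg n.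
have [gf_inj gf_surj] := qgf n; split=> [z Zz Bz|y Zy].
  by apply: gf_inj => //; apply: hom_boundaries Bz.
have [z Zz Byz] := gf_surj (g n y) (hom_cycles g Zy).
exists z => //; apply: g_inj.
  by rewrite /cycles /= linearB (hom_cycles f Zz) Zy subr0.
by rewrite linearB.
Qed.

End Composition.

Lemma weak_equivalence_two_out_of_three :
  two_out_of_three (@weak_equivalence k).
Proof.
move=> X Y Z f g; split.
- move=> [[X0 Y0 qf]|[X1 Y1]] [[Y0' Z0 qg]|[Y1' Z1]] //.
  + by left; split=> //; apply: quasi_isomorphism_comp qf qg.
  + by right.
- move=> [[X0 Y0 qf]|[X1 Y1]] [[X0' Z0 qgf]|[X1' Z1]] //.
  + by left; split=> //; apply: quasi_isomorphism_cancel_l qf qgf.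
  + by right.
- move=> [[Y0 Z0 qg]|[Y1 Z1]] [[X0 Z0' qgf]|[X1 Z1']] //.
  + by left; split=> //; apply: quasi_isomorphism_cancel_r qg qgf.
  + by right.
Qed.

Lemma cat_comp_app (A B C D : curvedLie_category k) (g : mor B C) (f : mor A B)
    (g' : mor D C) (f' : mor A D) :
  cat_comp g f = cat_comp g' f' -> forall n x, g n (f n x) = g' n (f' n x).
Proof.
move=> e n x.
exact: (congr1 (fun h : curvedLie_hom A C => h n x) e).
Qed.

Lemma cat_id_app (A B : curvedLie_category k) (g : mor B A) (f : mor A B) :
  cat_comp g f = cat_id A -> forall n x, g n (f n x) = x.
Proof.
move=> e n x.
exact: (congr1 (fun h : curvedLie_hom A A => h n x) e).
Qed.

Lemma weak_equivalence_retract : retract_closed (@weak_equivalence k).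
Proof.
move=> A B X Y f g [i [r [j [s [ri sj gi fr]]]]].
have {}ri := cat_id_app ri; have {}sj := cat_id_app sj.
have {}gi := cat_comp_app gi; have {}fr := cat_comp_app fr.
move=> [[X0 Y0 /quasi_isomorphismP qg]|[X1 Y1]]; last first.
  by right; split=> [/(hom_uncurved i)|/(hom_uncurved j)].
left; split; [exact: hom_uncurved r X0|exact: hom_uncurved s Y0|].
apply/quasi_isomorphismP => n; have [g_inj g_surj] := qg n.
split=> [z Zz /(hom_boundaries j)|y /(hom_cycles j) /g_surj[x Zx]].
  rewrite -gi => /(g_inj _ (hom_cycles i Zz)) /(hom_boundaries r).
  by rewrite ri.
move=> /(hom_boundaries s); rewrite linearB /= sj -fr => Byx.
by exists (r n x) => //; apply: hom_cycles.
Qed.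

Lemma fibration_retract : retract_closed (@fibration k).
Proof.
move=> A B X Y f g [i [r [j [s [_ sj _ fr]]]]] g_surj n y.
have [x gx] := g_surj n (j n y); exists (r n x).
by rewrite (cat_comp_app fr) gx (cat_id_app sj).
Qed.

End WeakEquivalences.

(** * The two factorizations and the lifting axiom *)

Lemma llp_retract (C : category) (P : map_class C) : retract_closed (llp P).
Proof.
move=> A B X Y f g [i [r [j [s [ri sj gi fr]]]]] llp_g E F q Pq u v quv.
have [|h [hg qh]] := llp_g E F q Pq (cat_comp u r) (cat_comp v s).
  by rewrite cat_compA quv -!cat_compA fr.
exists (cat_comp h j); split.
  by rewrite -cat_compA -gi cat_compA hg -cat_compA ri cat_idr.
by rewrite cat_compA qh -cat_compA sj cat_idr.
Qed.

Section Factorizations.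
Variable k : fieldType.
Local Notation LieCat := (curvedLie_category k).

Lemma factor_cof_acyclic_fib :
  factors_as (@cofibration k) (map_classI (@fibration k) (@weak_equivalence k)).
Proof.
move=> X Y f.
have [Z [i [p [HZ genZ iniZ]]]] :=
  @initial_filler_algebra k X Y f (uncurved Y) id.
have p_surj n y : exists x, p n x = y.
  by exists (fill (erefl (n - 1)) (0 : Z (n - 1)) y); exact: (fill_fill HZ).
exists (Z : curvedLie k), i, p; split; last first.
- by apply: curvedLie_hom_ext => n x; exact: (fill_over HZ).
- split=> //; have [Y0|Y1] := pselect (uncurved Y); last first.
    by right; split=> // /(hom_uncurved p).
  left; split=> //; first exact: fill_curv HZ Y0.
  apply: quasi_isomorphism_of_fills => // n m e c y dc dy.
  by exists (fill e c y); [exact: (fill_diff HZ)|exact: (fill_fill HZ)].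
move=> E B q [q_surj q_weq] u v quv.
have E0 : uncurved Y -> uncurved E /\ quasi_isomorphism q.
  move=> /(fill_curv HZ) /(hom_uncurved v) B0.
  by case: q_weq => [[]|[_ []]].
have [||||h [hi qh]] :=
  initial_filler_lift (u := u) (v := v) (q := q) HZ genZ iniZ.
- exact: cat_comp_app quv.
- exact: q_surj.
- by move=> /E0[].
- by move=> /E0[? ?]; apply: fills_of_quasi_isomorphism.
by exists h; split; apply: curvedLie_hom_ext.
Qed.

Hypothesis k_char0 : [pchar k] =i pred0.

(** [factor_acyclic_cof_fib] with a stronger lifting property on the left. *)
Lemma factor_disks (X Y : LieCat) (f : mor X Y) :
  exists (Z : LieCat) (i : mor X Z) (p : mor Z Y),
    [/\ llp (@fibration k) i, weak_equivalence i, fibration p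
      & cat_comp p i = f].
Proof.
have [//|Z [i [p [HZ genZ iniZ]]]] := @initial_filler_algebra k X Y f False.
exists (Z : curvedLie k), i, p; split.
- move=> E B q q_surj u v quv.
  have [||||h [hi qh]] :=
    initial_filler_lift (u := u) (v := v) (q := q) HZ genZ iniZ => //.
    exact: cat_comp_app quv.
  by exists h; split; apply: curvedLie_hom_ext.
- have [X0|X1] := pselect (uncurved X); last first.
    have [r _] := retraction_exists HZ genZ iniZ.
    by right; split=> // /(hom_uncurved r).
  left; split=> //; first exact: hom_uncurved i X0.
  have [D [D_br D_diff D_base D_fill D_null]] := weight_derivation HZ genZ iniZ.
  exact: (base_quasi_isomorphism HZ genZ iniZ D_br D_diff D_base D_fill D_null).
- move=> n y; exists (fill (erefl (n - 1)) (0 : Z (n - 1)) y).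
  exact: (fill_fill HZ).
- by apply: curvedLie_hom_ext => n x; exact: (fill_over HZ).
Qed.

Lemma factor_acyclic_cof_fib :
  factors_as (map_classI (@cofibration k) (@weak_equivalence k)) (@fibration k).
Proof.
move=> X Y f; have [Z [i [p [llp_i wi fp pi]]]] := factor_disks f.
exists Z, i, p; split=> //; split=> // E B q [fq _]; exact: llp_i.
Qed.

(** Factoring [i] as [p j] by [factor_disks], the map [p] is an acyclic
    fibration by two out of three, so lifting [i] against it exhibits [i] as a
    retract of [j]. *)
Lemma lift_acyclic_cof_fib (A B X Y : LieCat) (i : mor A B) (q : mor X Y) :
  map_classI (@cofibration k) (@weak_equivalence k) i -> fibration q ->
  has_lifting i q.
Proof.
move=> [ci wi] fq u v quv.
have [Z [j [p [llp_j wj fp pj]]]] := factor_disks i.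
have wp : weak_equivalence p.
  have [_ cancel _] := weak_equivalence_two_out_of_three j p.
  by apply: cancel; rewrite ?pj.
have [|h [hi ph]] := ci Z B p (conj fp wp) j (cat_id B).
  by rewrite pj cat_idl.
have [|l [lj ql]] := llp_j X Y q fq u (cat_comp v p).
  by rewrite quv -cat_compA pj.
exists (cat_comp l h); split; first by rewrite -cat_compA hi.
by rewrite cat_compA ql -cat_compA ph cat_idr.
Qed.

End Factorizations.

Theorem theorem5p10 (k : closedFieldType) (k_char0 : [pchar k] =i pred0) :
  closed_model_category (@weak_equivalence k) (@fibration k) (@cofibration k).
Proof.
split.
- exact: curvedLie_has_small_limits.
- exact: curvedLie_has_small_colimits.
- exact: weak_equivalence_two_out_of_three.
- exact: weak_equivalence_retract.
- exact: fibration_retract.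
- exact: llp_retract.
- by move=> A B X Y i p ci fp; apply: ci.
- by move=> A B X Y i p; apply: lift_acyclic_cof_fib.
- exact: factor_cof_acyclic_fib.
- exact: factor_acyclic_cof_fib.
Qed.
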